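(* Let $X$ be a smooth manifold, let $\mathfrak{G}$ be the Lie 2-group given by a smooth crossed module $(G,H,t,\alpha)$, let $F:\mathcal{P}_2(X)\to\mathcal{B}\mathfrak{G}$ be a smooth 2-functor, and let $A\in\Omega^1(X,\mathfrak{g})$ and $B\in\Omega^2(X,\mathfrak{h})$ be the corresponding differential forms. Then $$\mathrm{d}A+[A\wedge A]=t_*(B),$$ where $t_*:=\mathrm{d}t|_1:\mathfrak{h}\to\mathfrak{g}$.
   Context: **Crossed modules.** A smooth crossed module $(G,H,t,\alpha)$ consists of Lie groups $G,H$ (Lie algebras $\mathfrak{g},\mathfrak{h}$), a Lie group homomorphism $t:H\to G$ and a smooth left action $\alpha:G\times H\to H$ by Lie group homomorphisms $\alpha_g:=\alpha(g,\cdot)$, with $t(\alpha(g,h))=g\,t(h)\,g^{-1}$ and $\alpha(t(h),x)=hxh^{-1}$. $G\ltimes H$ has multiplication $(g_2,h_2)(g_1,h_1)=(g_2g_1,h_2\alpha(g_2,h_1))$. The strict 2-category $\mathcal{B}\mathfrak{G}$ has one object, 1-morphisms $g\in G$ with $g_2\circ g_1=g_2g_1$, and 2-morphisms $(g,h)\in G\ltimes H$, regarded as $g\Rightarrow t(h)g$; vertical composition is $(g',h')\bullet(g,h)=(g,h'h)$ for $g'=t(h)g$, horizontal composition is the product of $G\ltimes H$. $p_H:G\ltimes H\to H$ is the projection. **Paths and bigons.** A path $\gamma:x\to y$ is a smooth map $[0,1]\to X$ with, for some $0<\varepsilon<\frac12$, $\gamma(t)=x$ for $t<\varepsilon$ and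 $\gamma(t)=y$ for $t>1-\varepsilon$; $PX$ is the set of paths; $\gamma'\circ\gamma$ means first $\gamma$ then $\gamma'$ (double speed). A bigon $\Sigma:\gamma_0\Rightarrow\gamma_1$ between paths $\gamma_0,\gamma_1:x\to y$ is a smooth map $\Sigma:[0,1]^2\to X$ with, for some $0<\varepsilon<\frac12$, $\Sigma(s,t)=x$ for $t<\varepsilon$, $=y$ for $t>1-\varepsilon$, $=\gamma_0(t)$ for $s<\varepsilon$, $=\gamma_1(t)$ for $s>1-\varepsilon$; $BX$ is the set of bigons. Two paths are thin homotopy equivalent if there is a bigon between them whose differential has rank $\le1$ everywhere; $P^1X$ is the set of classes. Bigons $\Sigma,\Sigma'$ are thin homotopy equivalent if there is a smooth $h:[0,1]^3\to X$ and $0<\varepsilon<\frac12$ with $h(r,s,t)=x$ for $t<\varepsilon$, $=y$ for $t>1-\varepsilon$; $h(r,s,t)=h(r,0,t)$ for $s<\varepsilon$ and $=h(r,1,t)$ for $s>1-\varepsilon$; $h(r,s,t)=\Sigma(s,t)$ for $r<\varepsilon$ and $=\Sigma'(s,t)$ for $r>1-\varepsilon$; $\mathrm{rank}(\mathrm{d}h)\le2$ everywhere and $\mathrm{rank}(\mathrm{d}h|_{(r,i,t)})\le1$ for $i=0,1$. $B^2X$ is the set of classes. Vertical composition $\bullet$ is concatenation in $s$ (on classes: after inserting a thin homotopy between the matching paths), horizontal composition $\circ$ is concatenation in $t$. $\mathcal{P}_2(X)$ is the strict 2-category with objects $X$, 1-morphisms $P^1X$, 2-morphisms $B^2X$. **Smooth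 2-functors.** A map $f$ from $P^1X$ (resp. $B^2X$) to a smooth manifold is diffeological if for all open $U\subset\mathbb{R}^k$ and all $c:U\to PX$ (resp. $BX$) with $(u,t)\mapsto c(u)(t)$ (resp. $(u,s,t)\mapsto c(u)(s,t)$) smooth, the composite of $c$ with the projection to classes and $f$ is smooth. A strict 2-functor $F:\mathcal{P}_2(X)\to\mathcal{B}\mathfrak{G}$ is smooth if $F:P^1X\to G$ and $F:B^2X\to G\ltimes H$ are diffeological. **The forms of $F$.** $A_x(v)=-\frac{\mathrm d}{\mathrm dt}\big|_0F(\Gamma_*\gamma_{\mathbb R}(0,t))$, where $\Gamma:\mathbb{R}\to X$ is a smooth curve with $\Gamma(0)=x,\dot\Gamma(0)=v$ and $\gamma_{\mathbb R}(0,t)$ is the path (unique up to thin homotopy) in $\mathbb{R}$ from $0$ to $t$. $B_x(v_1,v_2)=-\frac{\partial^2}{\partial s\partial t}\big|_{(0,0)}p_H(F(\Gamma_*\Sigma_{\mathbb R}(s,t)))$ for any smooth $\Gamma:\mathbb{R}^2\to X$ with $\Gamma(0)=x$, $\partial_s\Gamma(0)=v_1$, $\partial_t\Gamma(0)=v_2$; here $\Sigma_{\mathbb R}(s,t)\in B^2\mathbb{R}^2$ is the unique class of bigons from the straight-line path $(0,0)\to(0,t)\to(s,t)$ to the path $(0,0)\to(s,0)\to(s,t)$. These are well-defined (independent of $\Gamma$) smooth forms. Convention: $[A\wedge A](v,w)=[A(v),A(w)]$. *)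

(* Defs.v *)
From HB Require Import structures.
From mathcomp Require Import all_boot all_order all_algebra.
From mathcomp Require Import all_classical all_reals all_analysis.

Set Implicit Arguments.
Unset Strict Implicit.
Unset Printing Implicit Defensive.

Import Order.TTheory GRing.Theory Num.Theory.
Import numFieldNormedType.Exports.

Local Open Scope classical_set_scope.
Local Open Scope ring_scope.

(* [U] is meant to be open. *)
Fixpoint Ck_on (R : realType) (V W : normedModType R) (k : nat)
    (U : set V) (f : V -> W) : Prop :=
  match k with
  | 0 => forall x, U x -> {for x, continuous f}
  | j.+1 => (forall x, U x -> differentiable f x) /\
            (forall v, Ck_on j U (fun x => 'D_v f x))
  end.

Definition smooth_on (R : realType) (V W : normedModType R)
    (U : set V) (f : V -> W) : Prop :=
  forall k, Ck_on k U f.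

(* The maps are total; only the values of [cmap] on [cdom] and of [cinv] on
   [cimg] matter. *)
Record chart (R : realType) (n : nat) (M : topologicalType) := Chart {
  cdom : set M;
  cmap : M -> 'rV[R]_n;
  cinv : 'rV[R]_n -> M;
  cdom_open : open cdom;
  cimg_open : open (cmap @` cdom);
  cmap_continuous : forall p, cdom p -> {for p, continuous cmap};
  cinv_continuous : forall y, (cmap @` cdom) y -> {for y, continuous cinv};
  cmapK : forall p, cdom p -> cinv (cmap p) = p
}.

Definition cimg (R : realType) (n : nat) (M : topologicalType)
  (c : chart R n M) : set 'rV[R]_n := cmap c @` cdom c.

(* The atlas is indexed by the points of the manifold: [chart_at p] is a chart
   around [p].  Every atlas contains such a family, which determines the same
   smooth structure.  The chart [chart_at p] also provides the identification
   of the tangent space at [p] with ['rV[R]_n] that is used throughout. *)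
HB.mixin Record isManifold (R : realType) (n : nat) M of Topological M := {
  chart_at : M -> chart R n M;
  chart_at_dom : forall p, cdom (chart_at p) p;
  chart_at_compat : forall p q,
    smooth_on (cmap (chart_at p) @` (cdom (chart_at p) `&` cdom (chart_at q)))
              (cmap (chart_at q) \o cinv (chart_at p));
  manifold_hausdorff : hausdorff_space M;
  manifold_second_countable : @second_countable M
}.

#[short(type="manifoldType")]
HB.structure Definition Manifold (R : realType) (n : nat) :=
  {M of Topological M & isManifold R n M}.

(* [U] is meant to be open. *)
Definition smooth_into (R : realType) (V : normedModType R) (n : nat)
    (M : manifoldType R n) (U : set V) (f : V -> M) : Prop :=
  (forall x, U x -> {for x, continuous f}) /\
  (forall p : M, smooth_on (U `&` f @^-1` cdom (chart_at p))
                           (cmap (chart_at p) \o f)).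

Definition smooth (R : realType) (m n : nat) (M : manifoldType R m)
    (N : manifoldType R n) (f : M -> N) : Prop :=
  forall p : M, smooth_into (cimg (chart_at p)) (f \o cinv (chart_at p)).

(* Smoothness out of the product manifold, in product charts. *)
Definition smooth2 (R : realType) (m n k : nat) (M : manifoldType R m)
    (N : manifoldType R n) (P : manifoldType R k) (f : M -> N -> P) : Prop :=
  forall (p : M) (q : N),
    smooth_into (cimg (chart_at p) `*` cimg (chart_at q))
      (fun z : 'rV[R]_m * 'rV[R]_n =>
         f (cinv (chart_at p) z.1) (cinv (chart_at q) z.2)).

(* The differential at [x], applied to [v], of a map from a normed space to a
   manifold, as an element of the tangent space at [f x]. *)
Definition tderive (R : realType) (V : normedModType R) (n : nat)
    (M : manifoldType R n) (f : V -> M) (x v : V) : 'rV[R]_n :=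
  'D_v (cmap (chart_at (f x)) \o f) x.

Definition tmap (R : realType) (m n : nat) (M : manifoldType R m)
    (N : manifoldType R n) (f : M -> N) (p : M) (v : 'rV[R]_m) : 'rV[R]_n :=
  tderive (f \o cinv (chart_at p)) (cmap (chart_at p) p) v.

(* The image of the differential lies in the row space of [P]. *)
Definition rank_le (R : realType) (V : normedModType R) (n : nat)
    (M : manifoldType R n) (k : nat) (f : V -> M) (x : V) : Prop :=
  exists P : 'M[R]_(k, n), forall v : V, (tderive f x v <= P)%MS.

Section Forms.
Variables (R : realType) (n m : nat) (X : manifoldType R n).

Definition form1 := X -> 'rV[R]_n -> 'rV[R]_m.
Definition form2 := X -> 'rV[R]_n -> 'rV[R]_n -> 'rV[R]_m.

(* Coordinate expressions of forms in [chart_at p]: pullbacks along the inverse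
   of that chart. *)
Definition form1_in_chart (A : form1) (p : X) (y v : 'rV[R]_n) : 'rV[R]_m :=
  let c := cinv (chart_at p) in A (c y) (tderive c y v).

Definition form2_in_chart (B : form2) (p : X) (y v w : 'rV[R]_n) : 'rV[R]_m :=
  let c := cinv (chart_at p) in B (c y) (tderive c y v) (tderive c y w).

Definition is_form1 (A : form1) : Prop :=
  (forall x, linear (A x)) /\
  (forall p v, smooth_on (cimg (chart_at p)) (form1_in_chart A p ^~ v)).

Definition is_form2 (B : form2) : Prop :=
  [/\ forall x v, linear (B x v),
      forall x w, linear (B x ^~ w),
      forall x v, B x v v = 0
    & forall p v w,
        smooth_on (cimg (chart_at p)) (fun y => form2_in_chart B p y v w)].

(* Computed in the chart at [x], with [v] and [w] extended to vector fields
   that are constant in that chart. *)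
Definition ext_deriv (A : form1) : form2 := fun x v w =>
  let y := cmap (chart_at x) x in
  'D_v (form1_in_chart A x ^~ w) y - 'D_w (form1_in_chart A x ^~ v) y.

End Forms.

HB.mixin Record isLieGroup (R : realType) (n : nat) G
    of Manifold R n G & Group G := {
  mulg_smooth : smooth2 (fun x y : G => (x * y)%g);
  invg_smooth : smooth (fun x : G => x^-1%g)
}.

#[short(type="lieGroupType")]
HB.structure Definition LieGroup (R : realType) (n : nat) :=
  {G of Manifold R n G & Group G & isLieGroup R n G}.

Section LieAlgebra.
Variables (R : realType) (n : nat) (G : lieGroupType R n).

Definition Ad (g : G) : 'rV[R]_n -> 'rV[R]_n :=
  tmap (fun h : G => (g * h * g^-1)%g) 1%g.

(* The bracket of the tangent space at 1: the derivative at 1, in the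
   direction [xi], of the map sending [g] to [Ad g eta]. *)
Definition lie_bracket (xi eta : 'rV[R]_n) : 'rV[R]_n :=
  let c := chart_at (1%g : G) in
  'D_xi (fun y => Ad (cinv c y) eta) (cmap c 1%g).

(* No factor 1/2 and no antisymmetrization. *)
Definition bracket_wedge (d : nat) (X : manifoldType R d)
    (A : form1 n X) : form2 n X :=
  fun x v w => lie_bracket (A x v) (A x w).

End LieAlgebra.

Section CrossedModule.
Variables (R : realType) (m k : nat).
Variables (G : lieGroupType R m) (H : lieGroupType R k).

Record crossed_module (t : H -> G) (alpha : G -> H -> H) : Prop := {
  cm_t_smooth : smooth t;
  cm_tM : forall h h', t (h * h')%g = (t h * t h')%g;
  cm_alpha_smooth : smooth2 alpha;
  cm_alpha1 : forall h, alpha 1%g h = h;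
  cm_alphaM : forall g g' h, alpha (g * g')%g h = alpha g (alpha g' h);
  cm_alpha_morph : forall g h h',
    alpha g (h * h')%g = (alpha g h * alpha g h')%g;
  cm_t_alpha : forall g h, t (alpha g h) = (g * t h * g^-1)%g;
  cm_peiffer : forall h x, alpha (t h) x = (h * x * h^-1)%g
}.

(* The 2-morphism [(g, h)] goes from [g] to [t h * g]. *)
Definition bg_src (b : G * H) : G := b.1.
Definition bg_tgt (t : H -> G) (b : G * H) : G := (t b.2 * b.1)%g.
Definition bg_id (g : G) : G * H := (g, 1%g).
Definition bg_vcomp (b' b : G * H) : G * H := (b.1, b'.2 * b.2)%g.
Definition bg_hcomp (alpha : G -> H -> H) (b2 b1 : G * H) : G * H :=
  (b2.1 * b1.1, b2.2 * alpha b2.1 b1.2)%g.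

End CrossedModule.

(* A path is constant near both ends of [0,1], hence extends uniquely to a
   smooth map on the whole line which is constant below and above; it is
   represented by this extension.  Bigons and homotopies are likewise extended
   from the square and the cube to the plane and to space.  All the conditions
   below (and smoothness of families of paths or bigons) hold for the
   extensions iff they hold on the interval, the square or the cube. *)

Section Sitting.
Variables (R : realType) (T : Type).

Definition sitting1 (gamma : R -> T) : Prop :=
  exists e : R, [/\ 0 < e, e < 2^-1
    & forall t, (t < e -> gamma t = gamma 0) /\
                (1 - e < t -> gamma t = gamma 1)].

(* [Sigma s t]: the source and target paths are [Sigma 0] and [Sigma 1], and
   the common end points are [Sigma 0 0] and [Sigma 0 1]. *)
Definition sitting2 (Sigma : R -> R -> T) : Prop :=
  exists e : R, [/\ 0 < e, e < 2^-1
    & forall s t, [/\ t < e -> Sigma s t = Sigma 0 0,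
                      1 - e < t -> Sigma s t = Sigma 0 1,
                      s < e -> Sigma s t = Sigma 0 t
                    & 1 - e < s -> Sigma s t = Sigma 1 t]].

(* First [gamma], then [gamma']. *)
Definition path_comp (gamma' gamma : R -> T) : R -> T := fun t =>
  if t <= 2^-1 then gamma (2 * t) else gamma' (2 * t - 1).

Definition bigon_vcomp (Sigma' Sigma : R -> R -> T) : R -> R -> T := fun s t =>
  if s <= 2^-1 then Sigma (2 * s) t else Sigma' (2 * s - 1) t.

Definition bigon_hcomp (Sigma2 Sigma1 : R -> R -> T) : R -> R -> T :=
  fun s => path_comp (Sigma2 s) (Sigma1 s).

End Sitting.

Section PathsBigons.
Variables (R : realType) (n : nat) (X : manifoldType R n).

Definition is_path (gamma : R -> X) : Prop :=
  smooth_into [set: R^o] gamma /\ sitting1 gamma.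

Definition uncurry2 (Sigma : R -> R -> X) : R^o * R^o -> X :=
  fun z => Sigma z.1 z.2.

Definition uncurry3 (h : R -> R -> R -> X) : R^o * R^o * R^o -> X :=
  fun z => h z.1.1 z.1.2 z.2.

Definition is_bigon (Sigma : R -> R -> X) : Prop :=
  smooth_into setT (uncurry2 Sigma) /\ sitting2 Sigma.

Definition is_thin_bigon (Sigma : R -> R -> X) : Prop :=
  is_bigon Sigma /\ forall z, rank_le 1 (uncurry2 Sigma) z.

Definition thin_path (gamma gamma' : R -> X) : Prop :=
  exists Sigma, [/\ is_thin_bigon Sigma, Sigma 0 = gamma & Sigma 1 = gamma'].

Definition thin_bigon (Sigma Sigma' : R -> R -> X) : Prop :=
  exists (h : R -> R -> R -> X) (e : R),
  [/\ smooth_into setT (uncurry3 h),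
      0 < e /\ e < 2^-1,
      forall r s t,
        [/\ t < e -> h r s t = Sigma 0 0,
            1 - e < t -> h r s t = Sigma 0 1,
            s < e -> h r s t = h r 0 t,
            1 - e < s -> h r s t = h r 1 t
          & (r < e -> h r s t = Sigma s t) /\
            (1 - e < r -> h r s t = Sigma' s t)],
      forall z, rank_le 2 (uncurry3 h) z
    & forall r t, rank_le 1 (uncurry3 h) (r, 0, t) /\
                  rank_le 1 (uncurry3 h) (r, 1, t)].

Definition is_path_plot (k : nat) (U : set 'rV[R]_k)
    (c : 'rV[R]_k -> R -> X) : Prop :=
  [/\ open U, forall u, U u -> is_path (c u)
    & smooth_into (U `*` setT) (fun z : 'rV[R]_k * R^o => c z.1 z.2)].

Definition is_bigon_plot (k : nat) (U : set 'rV[R]_k)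
    (c : 'rV[R]_k -> R -> R -> X) : Prop :=
  [/\ open U, forall u, U u -> is_bigon (c u)
    & smooth_into (U `*` setT)
        (fun z : 'rV[R]_k * (R^o * R^o) => c z.1 z.2.1 z.2.2)].

End PathsBigons.

(* Maps out of sets of thin homotopy classes are encoded as thin homotopy
   invariant maps on representatives; the values of [F1] and [F2] on functions
   that are not paths resp. bigons are irrelevant.  Vertical composition of
   classes needs a thin bigon [T] between the (only thinly homotopic) target
   of [Sigma] and source of [Sigma'].  Smoothness into the semidirect product
   of [G] and [H], which has the underlying manifold of [G * H], is
   componentwise. *)
Record smooth_2functor (R : realType) (n m k : nat) (X : manifoldType R n)
    (G : lieGroupType R m) (H : lieGroupType R k)
    (t : H -> G) (alpha : G -> H -> H)
    (F1 : (R -> X) -> G) (F2 : (R -> R -> X) -> G * H) : Prop := {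
  f1_thin : forall gamma gamma', is_path gamma -> is_path gamma' ->
    thin_path gamma gamma' -> F1 gamma = F1 gamma';
  f1_id : forall x : X, F1 (fun=> x) = 1%g;
  f1_comp : forall gamma gamma', is_path gamma -> is_path gamma' ->
    gamma 1 = gamma' 0 ->
    F1 (path_comp gamma' gamma) = (F1 gamma' * F1 gamma)%g;
  f2_thin : forall Sigma Sigma', is_bigon Sigma -> is_bigon Sigma' ->
    thin_bigon Sigma Sigma' -> F2 Sigma = F2 Sigma';
  f2_src : forall Sigma, is_bigon Sigma -> bg_src (F2 Sigma) = F1 (Sigma 0);
  f2_tgt : forall Sigma, is_bigon Sigma -> bg_tgt t (F2 Sigma) = F1 (Sigma 1);
  f2_id : forall gamma, is_path gamma ->
    F2 (fun=> gamma) = bg_id H (F1 gamma);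
  f2_vcomp : forall Sigma T Sigma',
    is_bigon Sigma -> is_thin_bigon T -> is_bigon Sigma' ->
    Sigma 1 = T 0 -> T 1 = Sigma' 0 ->
    F2 (bigon_vcomp Sigma' (bigon_vcomp T Sigma)) =
    bg_vcomp (F2 Sigma') (F2 Sigma);
  f2_hcomp : forall Sigma1 Sigma2, is_bigon Sigma1 -> is_bigon Sigma2 ->
    Sigma1 0 1 = Sigma2 0 0 ->
    F2 (bigon_hcomp Sigma2 Sigma1) = bg_hcomp alpha (F2 Sigma2) (F2 Sigma1);
  f1_smooth : forall d (U : set 'rV[R]_d) c, is_path_plot U c ->
    smooth_into U (fun u => F1 (c u));
  f2_smooth : forall d (U : set 'rV[R]_d) c, is_bigon_plot U c ->
    smooth_into U (fun u => (F2 (c u)).1) /\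
    smooth_into U (fun u => (F2 (c u)).2)
}.

Section StandardPathsBigons.
Variable R : realType.

Definition line_path (a b : R) (gamma : R -> R) : Prop :=
  [/\ smooth_on [set: R^o] (gamma : R^o -> R^o), sitting1 gamma,
      gamma 0 = a & gamma 1 = b].

(* A straight path when [f] is a path from 0 to 1 in the line; its thin
   homotopy class does not depend on [f]. *)
Definition segment (f : R -> R) (a b : R^o * R^o) : R -> R^o * R^o :=
  fun u => a + f u *: (b - a).

(* [Sigma] represents the class Sigma_R(s,t) of bigons in the plane. *)
Definition square_bigon (s t : R) (Sigma : R -> R -> R^o * R^o) : Prop :=
  [/\ smooth_on setT (fun z : R^o * R^o => Sigma z.1 z.2), sitting2 Sigma
    & exists2 f, line_path 0 1 f &
        Sigma 0 = path_comp (segment f (0, t) (s, t)) (segment f 0 (0, t)) /\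
        Sigma 1 = path_comp (segment f (s, 0) (s, t)) (segment f 0 (s, 0))].

End StandardPathsBigons.

Section FormsOfFunctor.
Variables (R : realType) (n m k : nat) (X : manifoldType R n).
Variables (G : lieGroupType R m) (H : lieGroupType R k).

(* The value of [F1] on a curve in the family is at the time [0] the unit of
   [G], so that the derivative is in the Lie algebra.  The chosen
   representatives [gamma] do not matter. *)
Definition is_form1_of (F1 : (R -> X) -> G) (A : form1 m X) : Prop :=
  forall (Gamma : R -> X) (gamma : R -> R -> R),
    smooth_into [set: R^o] Gamma ->
    (forall t, line_path 0 t (gamma t)) ->
    A (Gamma 0) (tderive (Gamma : R^o -> X) 0 1) =
    - tderive (fun t : R^o => F1 (Gamma \o gamma t)) 0 1.

(* For [t = 0] the bigon is thinly homotopic to an identity, so that the inner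
   derivative is in the Lie algebra of [H] for each [s]. *)
Definition is_form2_of (F2 : (R -> R -> X) -> G * H) (B : form2 k X) : Prop :=
  forall (Gamma : R^o * R^o -> X) (sigma : R -> R -> R -> R -> R^o * R^o),
    smooth_into setT Gamma ->
    (forall s t, square_bigon s t (sigma s t)) ->
    B (Gamma 0) (tderive Gamma 0 (1, 0)) (tderive Gamma 0 (0, 1)) =
    - 'D_1 (fun s : R^o =>
        tderive (fun t : R^o => (F2 (fun u v => Gamma (sigma s t u v))).2)
          0 1) 0.

End FormsOfFunctor.

(* Main.v *)
From HB Require Import structures.
Require Import Defs.
From mathcomp Require Import all_boot all_order all_algebra.
From mathcomp Require Import all_classical all_reals all_analysis.
From mathcomp Require Import ring lra.

Set Implicit Arguments.
Unset Strict Implicit.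
Unset Printing Implicit Defensive.

Import Order.TTheory GRing.Theory Num.Theory.
Import numFieldNormedType.Exports.

Local Open Scope classical_set_scope.
Local Open Scope ring_scope.

(** The 2-functor turns a small square in [X] into an identity between
    holonomies around its boundary, and the theorem is the second order term
    of that identity.

    Fix [x], [v], [w] and a smooth map [Gamma] of the plane into [X] through
    [x] with partial derivatives [v] and [w] there.  Write [hor b a] for the
    value of [F1] on the image of the segment from [(0, b)] to [(a, b)],
    [ver a b] for the one of the segment from [(a, 0)] to [(a, b)], and
    [sqr a b] for the [H]-component of [F2] on the rectangle that they bound.
    Source and target of this 2-morphism are the two ways around the rectangle,
    which gives (lemma [t_sqr])
      [t (sqr a b) = ver a b * hor 0 a * (hor b a * ver 0 b)^-1].
    Apply to both sides the derivative in [b] at [0], then the one in [a] at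
    [0].

    On the left, [sqr a 0 = 1] because a rectangle of height [0] is thinly
    homotopic to a constant family of paths (lemma [sqr0]), so all inner
    derivatives are in the Lie algebra of [H]; the differential of [t] is
    linear, and the definition of [B] gives minus the image of [B x v w].

    On the right, insert [hor 0 a] and its inverse: the expression is the
    product of [ver a b], of the conjugate of [(ver 0 b)^-1] by [hor 0 a], and
    of [hor 0 a * (hor b a)^-1].  All three are [1] at [b = 0], so that their
    derivatives in [b] add up there (lemma [tderive_mulg]).  In the direction
    of [a], the first one then gives minus the derivative of [A w] along [v];
    the second one is the derivative of an adjoint action, i.e. a Lie bracket,
    of [- A v] and [A w]; for the third one the derivatives are exchanged
    (Schwarz), which gives the derivative of [A v] along [w] (lemma
    [second_variation]).  The sum is minus the curvature of [A].

    Much of the text provides the calculus for this: smooth maps in the sense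
    of iterated directional derivatives compose, Schwarz's theorem, the
    differential of products in a Lie group, and explicit smooth families of
    paths and bigons with sitting instants, cut out of the function
    [exp (- 1 / x)].  The families are chosen so that the boundary of each
    bigon is literally a composite of the paths that define [hor] and [ver];
    thin homotopy enters only in [sqr0]. *)

(** * Maps of class Ck between normed spaces *)

(** Iterated derivatives are taken in fixed directions, whereas the chain rule
    differentiates the outer map in the direction of a derivative of the inner
    one, which varies; coordinates on the intermediate space reduce it to fixed
    directions.  Being a class lets instance search provide them for products. *)
Class fin_dim (R : realType) (V : normedModType R) : Prop := FinDim {
  fin_basis : exists (I : finType) (e : I -> V) (l : I -> {linear V -> R^o}),
    (forall i, continuous (l i)) /\ (forall v, v = \sum_i l i v *: e i)
}.

Section Derivatives.
Variable R : realType.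
Implicit Types V W Z : normedModType R.

Lemma derive_line V W (f : V -> W) (a v : V) :
  'D_1 (fun s : R^o => f (a + s *: v)) 0 = 'D_v f a.
Proof.
rewrite /derive; set g1 := fun h => h^-1 *: _; set g2 := fun h => h^-1 *: _.
suff -> : g1 = g2 by [].
by apply/funext => h; rewrite /g1 /g2 /= addr0 scale0r addr0 [_%:A]mulr1 [a + _]addrC.
Qed.

Lemma derive_comp V W Z (f : V -> W) (g : W -> Z) x v :
  differentiable f x -> differentiable g (f x) ->
  'D_v (g \o f) x = 'D_('D_v f x) g (f x).
Proof.
move=> df dg; rewrite deriveE; last exact: differentiable_comp.
by rewrite diff_comp// deriveE// deriveE.
Qed.

(** The differential is the zero map: the remainder vanishes near [x]. *)
Lemma near0_differentiable V W (f : V -> W) x :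
  (\forall y \near x, f y = 0) -> differentiable f x.
Proof.
move=> f0.
have fo : f \o shift x = cst (f x) + (\0 : {linear V -> W}) +o_ 0 id.
  apply/eqaddoP => _/posnumP[e]; have fx := nbhs_singleton f0.
  have : \forall h \near 0, f (h + x) = 0.
    by move: f0; rewrite (near_shift 0) subr0.
  apply: filterS => h fh.
  rewrite [X in `|X|](_ : _ = f (h + x) - (f x + 0))// fh fx addr0 subr0 normr0.
  exact: mulr_ge0.
have c0 : continuous (\0 : {linear V -> W}) by move=> ?; exact: cvg_cst.
apply/diff_locallyP; have -> // := diff_unique c0 fo.
Qed.

Lemma near_differentiable V W (f g : V -> W) x :
  (\forall y \near x, f y = g y) -> differentiable f x -> differentiable g x.
Proof.
move=> fg df.
have -> : g = f + (g - f) by apply/funext => y /=; rewrite /GRing.add/= addrC subrK.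
apply: differentiableD => //; apply: near0_differentiable.
by apply: filterS fg => y /= fgy; rewrite -[LHS]/(g y - f y) fgy subrr.
Qed.

Lemma scale_continuous W : continuous (fun p : R^o * W => p.1 *: p.2).
Proof. by move=> p; apply: cvgZ; [exact: cvg_fst|exact: cvg_snd]. Qed.

Lemma scale_is_bilinear W :
  bilinear_for
    (GRing.Scale.Law.clone _ _ *:%R _) (GRing.Scale.Law.clone _ _ *:%R _)
    (fun (a : R^o) (w : W) => a *: w).
Proof.
split=> [u'|u] a x y /=.
- by rewrite scalerDl scalerA.
- by rewrite scalerDr !scalerA mulrC.
Qed.

(** Scaling is a continuous bilinear map, composed here with a pair. *)
Lemma differentiable_scale V W (c : V -> R^o) (h : V -> W) x :
  differentiable c x -> differentiable h x ->
  differentiable (fun y => c y *: h y) x /\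
  forall v, 'D_v (fun y => c y *: h y) x = c x *: 'D_v h x + 'D_v c x *: h x.
Proof.
move=> dc dh.
pose bM := @bilinear_isBilinear.Build R R^o W W _ _ _ (@scale_is_bilinear W).
pose b : {bilinear R^o -> W -> W} := HB.pack (fun (a : R^o) (w : W) => a *: w) bM.
have dp := differentiable_pair dc dh.
have bc : continuous (fun p => b p.1 p.2) by exact: scale_continuous.
have db := @differentiable_bilin _ _ _ _ b (c x, h x) bc.
have E : (fun y => c y *: h y) = (fun p => b p.1 p.2) \o (fun y => (c y, h y)).
  by apply/funext.
have d : differentiable (fun y => c y *: h y) x.
  by rewrite E; exact: differentiable_comp.
split=> // v; rewrite deriveE// E diff_comp//.
have e1 := @diff_bilin _ _ _ _ b (c x, h x) bc.
rewrite -[LHS]/('d (fun p => b p.1 p.2) (c x, h x) ('d (fun y => (c y, h y)) x v)).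
by rewrite diff_pair// e1 /= !deriveE.
Qed.

Lemma derive_lin V W Z (l : {linear W -> Z}) (f : V -> W) x v :
  continuous l -> differentiable f x -> 'D_v (l \o f) x = l ('D_v f x).
Proof.
move=> lc df; have dl := @linear_differentiable _ _ _ l (f x) lc.
by rewrite derive_comp// [LHS]deriveE// diff_lin.
Qed.

End Derivatives.

Section Ck.
Variable R : realType.
Implicit Types V W Z : normedModType R.

(** As [Ck_on] only quantifies over the points of [U], it amounts to a
    condition at each of them; this is what makes smoothness a local notion. *)
Lemma Ck_onP V W k (U : set V) (f : V -> W) :
  Ck_on k U f <-> forall x, U x -> Ck_on k [set x] f.
Proof.
elim: k f => [|k IH] f /=.
  by split=> [h x Ux _ ->|h x Ux]; [exact: h|exact: (h x Ux)].
split=> [[df Df] x Ux|h].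
  by split=> [_ ->|v]; [exact: df|exact: (IH _).1].
split=> [x Ux|v]; first exact: (h x Ux).1.
by apply/IH => x Ux; exact: (h x Ux).2.
Qed.

Lemma Ck_on_sub V W k (U U' : set V) (f : V -> W) :
  U' `<=` U -> Ck_on k U f -> Ck_on k U' f.
Proof. by move=> U'U /Ck_onP h; apply/Ck_onP => x /U'U; exact: h. Qed.

Lemma Ck_on_eq V W k (U : set V) (f g : V -> W) :
  open U -> (forall x, U x -> f x = g x) -> Ck_on k U f -> Ck_on k U g.
Proof.
move=> oU; elim: k f g => [|k IH] f g fg /=.
  move=> fc x Ux; rewrite /prop_for /continuous_at -(fg x Ux).
  apply: cvg_trans (fc x Ux); apply: near_eq_cvg.
  by apply: filterS (open_nbhs_nbhs (conj oU Ux)) => y /fg ->.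
have nfg x : U x -> \forall y \near x, f y = g y.
  by move=> Ux; apply: filterS (open_nbhs_nbhs (conj oU Ux)).
move=> [df Df]; split=> [x Ux|v].
  exact: near_differentiable (nfg x Ux) (df x Ux).
apply: IH (Df v) => x Ux.
exact: near_eq_derive (nfg x Ux).
Qed.

Lemma Ck_on_pred V W k (U : set V) (f : V -> W) :
  Ck_on k.+1 U f -> Ck_on k U f.
Proof.
elim: k f => [|k IH] f [df Df]; last first.
  by split=> // v; apply: IH; exact: Df.
by move=> x Ux; apply: differentiable_continuous; exact: df.
Qed.

Lemma Ck_on_cst V W k (U : set V) (w : W) : Ck_on k U (fun=> w).
Proof.
elim: k w => [|k IH] w /=; first by move=> x _; exact: cst_continuous.
split=> [x _|v]; first exact: differentiable_cst.
rewrite (_ : 'D_v (fun=> w) = fun=> 0)//.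
by apply/funext => x; exact: derive_cst.
Qed.

Lemma Ck_on_lin V W k (U : set V) (l : {linear V -> W}) :
  continuous l -> Ck_on k U l.
Proof.
move=> lc; case: k => [|k] /=; first by move=> x _; exact: lc.
split=> [x _|v]; first exact: linear_differentiable.
rewrite (_ : 'D_v l = fun=> l v); first exact: Ck_on_cst.
by apply/funext => x; rewrite deriveE ?diff_lin//; exact: linear_differentiable.
Qed.

Lemma Ck_on_lincomp V W Z k (U : set V) (l : {linear W -> Z}) (f : V -> W) :
  open U -> continuous l -> Ck_on k U f -> Ck_on k U (l \o f).
Proof.
move=> oU lc; elim: k f => [|k IH] f /=.
  by move=> fc x Ux; apply: continuous_comp; [exact: fc|exact: lc].
move=> [df Df]; split=> [x Ux|v].
  by apply: differentiable_comp; [exact: df|exact: linear_differentiable].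
apply: Ck_on_eq (IH _ (Df v)) => // x Ux /=.
by rewrite derive_lin//; exact: df.
Qed.

Lemma Ck_onD V W k (U : set V) (f g : V -> W) :
  open U -> Ck_on k U f -> Ck_on k U g -> Ck_on k U (fun x => f x + g x).
Proof.
move=> oU; elim: k f g => [|k IH] f g /=.
  by move=> fc gc x Ux; apply: cvgD; [exact: fc|exact: gc].
move=> [df Df] [dg Dg]; split=> [x Ux|v].
  by apply: differentiableD; [exact: df|exact: dg].
apply: Ck_on_eq (IH _ _ (Df v) (Dg v)) => // x Ux /=.
by rewrite [RHS]deriveD//; apply: diff_derivable; [exact: df|exact: dg].
Qed.

Lemma Ck_on_sum V W k (U : set V) (I : finType) (f : I -> V -> W) :
  open U -> (forall i, Ck_on k U (f i)) -> Ck_on k U (fun x => \sum_i f i x).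
Proof.
move=> oU h; elim: (index_enum I) => [|i r IH].
  rewrite (_ : (fun _ => _) = fun=> 0); first exact: Ck_on_cst.
  by apply/funext => x; rewrite big_nil.
rewrite (_ : (fun _ => _) = fun x => f i x + \sum_(j <- r) f j x).
  exact: Ck_onD.
by apply/funext => x; rewrite big_cons.
Qed.

(** By the product rule, both terms of the derivative are again products; one
    factor of each has lost an order of differentiability, the other one has
    to be weakened to match it. *)
Lemma Ck_onZ V W k (U : set V) (c : V -> R^o) (h : V -> W) :
  open U -> Ck_on k U c -> Ck_on k U h -> Ck_on k U (fun x => c x *: h x).
Proof.
move=> oU; elim: k c h => [|k IH] c h.
  by move=> cc hc x Ux; apply: cvgZ; [exact: cc|exact: hc].
move=> cS hS; have [dc Dc] := cS; have [dh Dh] := hS; split=> [x Ux|v].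
  by have [] := differentiable_scale (dc x Ux) (dh x Ux).
have ck := Ck_on_pred cS; have hk := Ck_on_pred hS.
apply: Ck_on_eq (Ck_onD oU (IH _ _ ck (Dh v)) (IH _ _ (Dc v) hk)) => // x Ux /=.
by have [_ ->] := differentiable_scale (dc x Ux) (dh x Ux).
Qed.

(** In coordinates [l i] on [W], the derivative of a composite is a sum of
    products of [l i ('D_v f)] with composites of partial derivatives of [g],
    to which the induction hypothesis applies. *)
Lemma Ck_on_comp V W Z k (U : set V) (O : set W) (f : V -> W) (g : W -> Z) :
  fin_dim W -> open U -> (forall x, U x -> O (f x)) ->
  Ck_on k U f -> Ck_on k O g -> Ck_on k U (g \o f).
Proof.
move=> [[n [e [l [lc le]]]]] oU UO; elim: k f g UO => [|k IH] f g UO.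
  move=> fc gc x Ux; apply: continuous_comp; first exact: fc.
  exact: (gc _ (UO _ Ux)).
move=> fS gS; have [df Df] := fS; have [dg Dg] := gS; split=> [x Ux|v].
  by apply: differentiable_comp; [exact: df|apply: dg; exact: UO].
have fk := Ck_on_pred fS.
apply: (@Ck_on_eq _ _ _ _ (fun x => \sum_i l i ('D_v f x) *: ('D_(e i) g \o f) x)) => //.
  move=> x Ux; have dgx := dg _ (UO _ Ux).
  rewrite derive_comp//; last exact: df.
  rewrite [RHS]deriveE// [in RHS](le ('D_v f x)) linear_sum.
  by apply: eq_bigr => i _; rewrite linearZ; congr (_ *: _); exact: deriveE.
apply: Ck_on_sum => // i; apply: Ck_onZ => //.
  exact: (Ck_on_lincomp oU (lc i) (Df v)).
exact: (IH f _ UO fk (Dg (e i))).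
Qed.

Lemma Ck_on_pair V W Z k (U : set V) (f : V -> W) (g : V -> Z) :
  open U -> Ck_on k U f -> Ck_on k U g -> Ck_on k U (fun x => (f x, g x)).
Proof.
move=> oU; elim: k f g => [|k IH] f g /=.
  by move=> fc gc x Ux; apply: cvg_pair; [exact: fc|exact: gc].
move=> [df Df] [dg Dg]; split=> [x Ux|v].
  by apply: differentiable_pair; [exact: df|exact: dg].
apply: Ck_on_eq (IH _ _ (Df v) (Dg v)) => // x Ux /=.
have dfx := df x Ux; have dgx := dg x Ux.
by rewrite [RHS]deriveE ?diff_pair ?deriveE//; exact: differentiable_pair.
Qed.

End Ck.

(** * Smoothness near a point *)

Section FinDim.
Variable R : realType.

#[global] Instance fin_dim_regular : fin_dim R^o.
Proof.
split; exists unit, (fun=> 1), (fun=> idfun); split=> [_|v].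
  by move=> x; exact: cvg_id.
by rewrite (bigD1 tt)//= big1 ?addr0 ?[_ *: _]mulr1//; case.
Qed.

#[global] Instance fin_dim_rV n : fin_dim 'rV[R]_n.
Proof.
have lin (i : 'I_n) : linear (fun v : 'rV[R]_n => v ord0 i : R^o).
  by move=> a u v; rewrite !mxE.
pose l i : {linear 'rV[R]_n -> R^o} :=
  HB.pack (fun v : 'rV[R]_n => v ord0 i : R^o)
    (GRing.isLinear.Build _ _ _ _ _ (lin i)).
split; exists 'I_n, (fun i => delta_mx ord0 i), l; split=> [i|v].
  exact: coord_continuous.
exact: row_sum_delta.
Qed.

#[global] Instance fin_dim_prod (V W : normedModType R) :
  fin_dim V -> fin_dim W -> fin_dim (V * W)%type.
Proof.
move=> [[I [e [l [lc le]]]]] [[I' [e' [l' [lc' le']]]]].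
pose E (i : I + I') : V * W :=
  match i with inl j => (e j, 0) | inr j => (0, e' j) end.
pose L1 j : {linear (V * W)%type -> R^o} := l j \o fst.
pose L2 j : {linear (V * W)%type -> R^o} := l' j \o snd.
pose L (i : I + I') := match i with inl j => L1 j | inr j => L2 j end.
split; exists (I + I')%type, E, L; split=> [[] j x|v].
- by apply: continuous_comp; [exact: cvg_fst|exact: lc].
- by apply: continuous_comp; [exact: cvg_snd|exact: lc'].
rewrite big_sumType /=.
have -> : \sum_i l i v.1 *: (e i, 0 : W) = (v.1, 0).
  rewrite [in RHS](le v.1).
  elim/big_ind2: _ => [//|a b c d -> -> |i _].
    by rewrite -[LHS]/(_ + _, _ + _) addr0.
  by rewrite -[LHS]/(_ *: _, _ *: _) scaler0.
have -> : \sum_i l' i v.2 *: (0 : V, e' i) = (0, v.2).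
  rewrite [in RHS](le' v.2).
  elim/big_ind2: _ => [//|a b c d -> -> |i _].
    by rewrite -[LHS]/(_ + _, _ + _) addr0.
  by rewrite -[LHS]/(_ *: _, _ *: _) scaler0.
by case: v => a b; rewrite -[_ + _]/(a + 0, 0 + b) addr0 add0r.
Qed.

End FinDim.

(** A single neighbourhood has to serve for all orders of differentiation, so
    that directional derivatives of [f] are again smooth near [x]. *)
Definition smooth_near (R : realType) (V W : normedModType R) (f : V -> W)
  (x : V) := exists U, [/\ open U, U x & smooth_on U f].

Lemma near_open (T : topologicalType) (x : T) (P : T -> Prop) :
  (\forall y \near x, P y) -> exists U, [/\ open U, U x & U `<=` P].
Proof. by rewrite /prop_near1 nbhsE => -[U [oU Ux] UP]; exists U. Qed.

Section SmoothNear.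
Variable R : realType.
Implicit Types V W Z : normedModType R.

Lemma smooth_onP V W (U : set V) (f : V -> W) : open U ->
  smooth_on U f <-> forall x, U x -> smooth_near f x.
Proof.
move=> oU; split=> [sf x Ux|h k]; first by exists U.
apply/Ck_onP => x Ux; have [N [oN Nx sf]] := h x Ux.
by apply: Ck_on_sub (sf k) => _ ->.
Qed.

Lemma smooth_near_eq V W (f g : V -> W) x :
  (\forall y \near x, f y = g y) -> smooth_near f x -> smooth_near g x.
Proof.
move=> /near_open[N [oN Nx fg]] [U [oU Ux sf]].
have oNU := openI oN oU.
exists (N `&` U); split=> // k; apply: (@Ck_on_eq _ _ _ _ _ f) => //.
  by move=> y [Ny _]; exact: fg.
by apply: Ck_on_sub (sf k) => y [].
Qed.

Lemma smooth_near_differentiable V W (f : V -> W) x :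
  smooth_near f x -> differentiable f x.
Proof. by move=> [U [oU Ux sf]]; exact: (sf 1%N).1. Qed.

Lemma smooth_near_derivable V W (f : V -> W) x v :
  smooth_near f x -> derivable f x v.
Proof. by move/smooth_near_differentiable/diff_derivable. Qed.

Lemma smooth_near_continuous V W (f : V -> W) x :
  smooth_near f x -> {for x, continuous f}.
Proof. by move/smooth_near_differentiable/differentiable_continuous. Qed.

Lemma smooth_near_near V W (f : V -> W) x :
  smooth_near f x -> \forall y \near x, smooth_near f y.
Proof.
move=> [U [oU Ux sf]]; apply: filterS (open_nbhs_nbhs (conj oU Ux)) => y Uy.
by exists U.
Qed.

Lemma smooth_near_derive V W (f : V -> W) x v :
  smooth_near f x -> smooth_near ('D_v f) x.
Proof.
by move=> [U [oU Ux sf]]; exists U; split=> // k; exact: (sf k.+1).2.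
Qed.

Lemma smooth_near_cst V W (w : W) (x : V) : smooth_near (fun=> w) x.
Proof. by exists setT; split=> // [|k]; [exact: openT|exact: Ck_on_cst]. Qed.

Lemma smooth_near_lin V W (l : {linear V -> W}) x :
  continuous l -> smooth_near l x.
Proof.
by move=> lc; exists setT; split=> // [|k]; [exact: openT|exact: Ck_on_lin].
Qed.

Lemma smooth_nearD V W (f g : V -> W) x :
  smooth_near f x -> smooth_near g x -> smooth_near (fun y => f y + g y) x.
Proof.
move=> [U [oU Ux sf]] [N [oN Nx sg]]; have oNU := openI oN oU.
exists (N `&` U); split=> // k.
by apply: Ck_onD => //; [apply: Ck_on_sub (sf k)|apply: Ck_on_sub (sg k)] => y [].
Qed.

Lemma smooth_nearZ V W (c : V -> R^o) (f : V -> W) x :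
  smooth_near c x -> smooth_near f x -> smooth_near (fun y => c y *: f y) x.
Proof.
move=> [U [oU Ux sf]] [N [oN Nx sg]]; have oNU := openI oN oU.
exists (N `&` U); split=> // k.
by apply: Ck_onZ => //; [apply: Ck_on_sub (sf k)|apply: Ck_on_sub (sg k)] => y [].
Qed.

Lemma smooth_nearM V (f g : V -> R^o) x :
  smooth_near f x -> smooth_near g x -> smooth_near (fun y => f y * g y : R^o) x.
Proof. exact: smooth_nearZ. Qed.

Lemma smooth_nearN V W (f : V -> W) x :
  smooth_near f x -> smooth_near (fun y => - f y) x.
Proof.
move=> sf; have := smooth_nearZ (smooth_near_cst (-1 : R^o) x) sf.
by apply: smooth_near_eq; near=> y; rewrite scaleN1r.
Unshelve. all: by end_near. Qed.

Lemma smooth_nearB V W (f g : V -> W) x :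
  smooth_near f x -> smooth_near g x -> smooth_near (fun y => f y - g y) x.
Proof. by move=> sf sg; apply: smooth_nearD => //; exact: smooth_nearN. Qed.

Lemma smooth_near_pair V W Z (f : V -> W) (g : V -> Z) x :
  smooth_near f x -> smooth_near g x -> smooth_near (fun y => (f y, g y)) x.
Proof.
move=> [U [oU Ux sf]] [N [oN Nx sg]]; have oNU := openI oN oU.
exists (N `&` U); split=> // k.
by apply: Ck_on_pair => //;
  [apply: Ck_on_sub (sf k)|apply: Ck_on_sub (sg k)] => y [].
Qed.

Lemma smooth_near_comp V W Z {fd : fin_dim W} (f : V -> W) (g : W -> Z) x :
  smooth_near f x -> smooth_near g (f x) -> smooth_near (g \o f) x.
Proof.
move=> sf [N [oN Nx sg]]; have := smooth_near_continuous sf.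
move=> /(_ N (open_nbhs_nbhs (conj oN Nx))).
move=> /near_open[U' [oU' U'x U'N]].
move: sf => [U [oU Ux sf]]; have oUU' := openI oU oU'.
exists (U `&` U'); split=> // k.
apply: (@Ck_on_comp _ _ _ _ _ _ N) => //.
- by move=> y [_ /U'N].
- by apply: Ck_on_sub (sf k) => y [].
Qed.

Lemma smooth_near_fst V W (p : V * W) : smooth_near fst p.
Proof. by apply: (@smooth_near_lin _ _ fst) => q; exact: cvg_fst. Qed.

Lemma smooth_near_snd V W (p : V * W) : smooth_near snd p.
Proof. by apply: (@smooth_near_lin _ _ snd) => q; exact: cvg_snd. Qed.

Lemma smooth_near_id V (x : V) : smooth_near id x.
Proof. by apply: (@smooth_near_lin _ _ idfun) => q; exact: cvg_id. Qed.

End SmoothNear.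

(** * A smooth step function *)

Section OneVariable.
Variable R : realType.

Lemma Ck_on_derive1 (W : normedModType R) k (U : set R^o) (f f' : R^o -> W) :
  open U -> (forall x : R^o, U x -> is_derive x (1 : R^o) f (f' x)) ->
  Ck_on k U f' -> Ck_on k.+1 U f.
Proof.
move=> oU df cf'; have dif x : U x -> differentiable f x.
  by move=> /df dfx; apply/derivable1_diffP; exact: ex_derive.
split=> // v; apply: (@Ck_on_eq _ _ _ _ _ (fun x => v *: f' x)) => //.
  move=> x Ux; have dfx := df x Ux; have dx := dif x Ux.
  rewrite deriveE// -[v in RHS]mulr1 -[v * 1]/(v *: 1) linearZ/= -deriveE//.
  by rewrite derive_val.
by apply: Ck_onZ => //; exact: Ck_on_cst.
Qed.

(** Sine and cosine are treated together, each being up to sign the derivative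
    of the other. *)
Lemma smooth_near_sin (x : R^o) : smooth_near (sin : R^o -> R^o) x.
Proof.
exists setT; split=> // [|k]; first exact: openT.
suff [] : Ck_on k setT (sin : R^o -> R^o) /\ Ck_on k setT (cos : R^o -> R^o) by [].
have oT := @openT R^o.
elim: k => [|k [IHs IHc]].
  by split=> y _; [exact: continuous_sin|exact: continuous_cos].
split; first by apply: (@Ck_on_derive1 _ _ _ _ cos).
apply: (@Ck_on_derive1 _ _ _ _ (fun y => - sin y : R^o)) => //.
rewrite (_ : (fun _ => _) = (-1 : R^o) \*: (sin : R^o -> R^o)).
  by apply: Ck_onZ => //; exact: Ck_on_cst.
by apply/funext => y /=; rewrite scaleN1r.
Qed.

Lemma smooth_near_inv (x : R^o) : x != 0 -> smooth_near (fun y : R^o => y^-1 : R^o) x.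
Proof.
move=> x0; have oU : open [set y : R^o | y != 0].
  rewrite (_ : [set _ | _] = ~` [set 0]); last by apply/seteqP; split=> y /eqP.
  by rewrite openC; exact: closed_eq.
exists [set y : R^o | y != 0]; split=> //; elim=> [y y0|k IH].
  exact: (inv_continuous y0).
apply: (@Ck_on_derive1 _ _ _ _ (fun y : R^o => (-1) *: (y^-1 *: y^-1) : R^o)) => //.
  move=> y y0; have H := @is_deriveV _ id y 1 1 y0 (is_derive_id y 1).
  by apply: (is_derive_eq H); rewrite /= scaleN1r [LHS]mulr1 -exprVn expr2.
by apply: Ck_onZ => //; [exact: Ck_on_cst|exact: Ck_onZ].
Qed.

(** The function [x ^- m * exp (- 1 / x)], continued by [0].  The derivative of
    [flat_exp m] is a combination of [flat_exp m.+1] and [flat_exp m.+2], so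
    that induction over the order of differentiation works for the whole
    family. *)
Definition flat_exp (m : nat) (x : R) : R :=
  if 0 < x then x^-1 ^+ m * expR (- x^-1) else 0.

(** The exponential series dominates its term of degree [m.+2].  A quadratic
    bound is what makes the derivative at [0] vanish. *)
Lemma flat_exp_le m (x : R) : `|flat_exp m x| <= m.+2`!%:R * `|x| * `|x|.
Proof.
rewrite /flat_exp; case: ifP => [x0|_]; last by rewrite normr0 !mulr_ge0.
have y0 : 0 < x^-1 by rewrite invr_gt0.
rewrite !(gtr0_norm x0) gtr0_norm; last by rewrite mulr_gt0 ?exprn_gt0 ?expR_gt0.
have E := expR_ge1Dxn m.+1 (ltW y0).
have {}E : x^-1 ^+ m.+2 <= m.+2`!%:R * expR x^-1.
  rewrite -ler_pdivrMl ?ltr0n ?fact_gt0// mulrC; apply: le_trans E.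
  by rewrite lerDr.
have -> : x^-1 ^+ m = x * x * x^-1 ^+ m.+2.
  by rewrite -addn2 exprD mulrC -mulrA -!expr2 -exprMn mulVf ?gt_eqF// expr1n mulr1.
have -> : m.+2`!%:R * x * x = x * x * m.+2`!%:R by ring.
rewrite -[_ * _ * expR _]mulrA ler_pM2l ?mulr_gt0// expRN.
by rewrite ler_pdivrMr ?expR_gt0//.
Qed.

Lemma is_derive_flat_exp m (x : R) :
  is_derive (x : R^o) (1 : R^o) (flat_exp m : R^o -> R^o)
    (- m%:R * flat_exp m.+1 x + flat_exp m.+2 x).
Proof.
have [x0|x0|->] := ltgtP x 0.
- have -> : - m%:R * flat_exp m.+1 x + flat_exp m.+2 x = 0.
    by rewrite /flat_exp ltNge ltW//= mulr0 addr0.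
  apply: (near_eq_is_derive _ (@is_derive_cst R R^o R^o 0 x 1)).
  by near=> y; rewrite /flat_exp ltNge ltW//=; near: y; exact: lt_nbhsl.
- have d1 := @is_deriveV _ id x 1 1 (lt0r_neq0 x0) (is_derive_id x 1).
  have d3 := is_deriveN d1.
  have d4 := @is_derive1_comp R expR (fun y => - y^-1) x _ _ (is_derive_expR _) d3.
  have d2 := is_deriveX m d1.
  have d5 : is_derive x 1 (fun x : R => x^-1 ^+ m * expR (- x^-1))
      (- m%:R * flat_exp m.+1 x + flat_exp m.+2 x).
    have -> : (fun x : R => x^-1 ^+ m * expR (- x^-1)) =
        ((fun y : R => y^-1) ^+ m) * (expR \o (fun y => - y^-1)).
      by apply/funext => y; rewrite fctE exprfctE.
    apply: (is_derive_eq (is_deriveM d2 d4)).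
    rewrite /flat_exp x0 exprfctE /= /GRing.scale /= !mulr1 -exprVn.
    by case: (m) => [|j] /=; rewrite ?exprS ?expr0 ?mulrSr; ring.
  apply: (near_eq_is_derive _ d5).
  by near=> y; rewrite /flat_exp ifT//; near: y; exact: lt_nbhsr.
- have -> : - m%:R * flat_exp m.+1 0 + flat_exp m.+2 0 = 0 :> R.
    by rewrite /flat_exp ltxx mulr0 addr0.
  have f0 : flat_exp m 0 = 0 by rewrite /flat_exp ltxx.
  suff H : h^-1 *: ((flat_exp m \o shift (0 : R)) (h *: (1 : R)) - flat_exp m 0)
      @[h --> (0 : R)^'] --> (0 : R).
    by apply: DeriveDef; [apply/cvg_ex; exists 0|exact: cvg_lim].
  apply/cvgrPdist_le => e e0; near=> h.
  have h0 : h != 0 by near: h; exact: nbhs_dnbhs_neq.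
  rewrite f0 sub0r subr0 normrN /= addr0 [_ *: 1]mulr1 normrZ normfV.
  rewrite ler_pdivrMl ?normr_gt0// (le_trans (flat_exp_le _ _))//.
  rewrite mulrC ler_pM2l ?normr_gt0// -ler_pdivlMl ?ltr0n ?fact_gt0//.
  near: h; apply: dnbhs0_le.
  by rewrite mulr_gt0// invr_gt0 ltr0n fact_gt0.
Unshelve. all: by end_near. Qed.

Lemma smooth_near_flat_exp m (x : R^o) :
  smooth_near (flat_exp m : R^o -> R^o) x.
Proof.
have oT := @openT R^o; exists setT; split=> // k.
elim: k m => [m y _|k IH m].
  apply/differentiable_continuous/derivable1_diffP.
  exact: (@ex_derive _ _ _ _ _ _ _ (is_derive_flat_exp m y)).
apply: (@Ck_on_derive1 _ _ _ _ (fun y : R^o =>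
  (- (m%:R : R)) *: flat_exp m.+1 y + flat_exp m.+2 y : R^o)) => //.
  by move=> y _; exact: is_derive_flat_exp.
by apply: Ck_onD => //; apply: Ck_onZ => //; exact: Ck_on_cst.
Qed.

(** A smooth function from [0] to [1], constant outside [[1/4, 3/4]]: the
    reparametrisation that gives straight paths their sitting instants. *)
Definition step (x : R) : R :=
  flat_exp 0 (x - 4^-1) / (flat_exp 0 (x - 4^-1) + flat_exp 0 (1 - x - 4^-1)).

Lemma flat_exp_ge0 m (x : R) : 0 <= flat_exp m x.
Proof.
rewrite /flat_exp; case: ifP => // x0.
by rewrite mulr_ge0 ?expR_ge0 ?exprn_ge0 ?invr_ge0 ?ltW.
Qed.

Lemma flat_exp_gt0 m (x : R) : 0 < x -> 0 < flat_exp m x.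
Proof.
by move=> x0; rewrite /flat_exp x0 mulr_gt0 ?expR_gt0 ?exprn_gt0 ?invr_gt0.
Qed.

Lemma step0 (x : R) : x <= 4^-1 -> step x = 0.
Proof. by move=> h; rewrite /step /flat_exp subr_gt0 ltNge h mul0r. Qed.

Lemma step1 (x : R) : 1 - 4^-1 <= x -> step x = 1.
Proof.
move=> h; have z : flat_exp 0 (1 - x - 4^-1) = 0.
  by rewrite /flat_exp ifF//; apply/negbTE; rewrite -leNgt; lra.
by rewrite /step z addr0 divff// gt_eqF//; apply: flat_exp_gt0; lra.
Qed.

Lemma smooth_near_step (x : R^o) : smooth_near (step : R^o -> R^o) x.
Proof.
have s1 : smooth_near (fun y : R^o => flat_exp 0 (y - 4^-1) : R^o) x.
  apply: (@smooth_near_comp _ _ _ _ _ (fun y : R^o => y - 4^-1 : R^o)) => //.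
    by apply: smooth_nearB; [exact: smooth_near_id|exact: smooth_near_cst].
  exact: smooth_near_flat_exp.
have s2 : smooth_near (fun y : R^o => flat_exp 0 (1 - y - 4^-1) : R^o) x.
  apply: (@smooth_near_comp _ _ _ _ _ (fun y : R^o => 1 - y - 4^-1 : R^o)) => //.
    apply: smooth_nearB; last exact: smooth_near_cst.
    by apply: smooth_nearB; [exact: smooth_near_cst|exact: smooth_near_id].
  exact: smooth_near_flat_exp.
apply: smooth_nearM => //.
apply: (@smooth_near_comp _ _ _ _ _ (fun y : R^o =>
  flat_exp 0 (y - 4^-1) + flat_exp 0 (1 - y - 4^-1) : R^o) (fun y : R^o => y^-1 : R^o)).
  exact: smooth_nearD.
apply: smooth_near_inv; rewrite gt_eqF//.
have [h|h] := ltP (4^-1) (x : R).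
  by rewrite ltr_wpDr ?flat_exp_ge0// flat_exp_gt0// subr_gt0.
rewrite ltr_pwDr ?flat_exp_ge0// flat_exp_gt0//.
by move: (x : R) h => y h; lra.
Qed.

End OneVariable.

(** * Smooth maps into manifolds and Lie groups *)

(** Continuity at [x] alone is enough for [f] to stay in the domain of a chart
    near [x]. *)
Definition smooth_at (R : realType) (V : normedModType R) (n : nat)
    (M : manifoldType R n) (f : V -> M) (x : V) : Prop :=
  {for x, continuous f} /\
  forall q, cdom (chart_at q) (f x) -> smooth_near (cmap (chart_at q) \o f) x.

Section SmoothAt.
Variable R : realType.
Implicit Types V W : normedModType R.

Lemma near_cdom V n (M : manifoldType R n) (f : V -> M) x q :
  {for x, continuous f} -> cdom (chart_at q) (f x) ->
  \forall y \near x, cdom (chart_at q) (f y).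
Proof.
move=> fc dfx; apply: (fc (cdom (chart_at q))).
by apply: open_nbhs_nbhs; split => //; exact: cdom_open.
Qed.

Lemma smooth_intoP V n (M : manifoldType R n) (U : set V) (f : V -> M) :
  open U -> smooth_into U f <-> forall x, U x -> smooth_at f x.
Proof.
move=> oU.
have oq q : (forall x, U x -> {for x, continuous f}) ->
    open (U `&` f @^-1` cdom (chart_at q)).
  move=> fc; rewrite openE => y [Uy dy].
  apply: filterS2 (open_nbhs_nbhs (conj oU Uy)) (near_cdom (fc y Uy) dy).
  by move=> z Uz dz; split.
split=> [[fc fs] x Ux|h].
  split=> [|q dx]; first exact: fc.
  exact: ((smooth_onP _ (oq q fc)).1 (fs q) x (conj Ux dx)).
have fc x : U x -> {for x, continuous f} by move=> Ux; exact: (h x Ux).1.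
split=> // q; apply/(smooth_onP _ (oq q fc)) => x [Ux dx].
exact: (h x Ux).2.
Qed.

Lemma smooth_at_eq V n (M : manifoldType R n) (f g : V -> M) x :
  (\forall y \near x, f y = g y) -> smooth_at f x -> smooth_at g x.
Proof.
move=> fg [fc fs]; have fgx := nbhs_singleton fg; split=> [|q].
  rewrite /prop_for /continuous_at -fgx.
  by apply: cvg_trans fc; apply: near_eq_cvg; apply: filterS fg => y ->.
rewrite -fgx => /fs; apply: smooth_near_eq.
by apply: filterS fg => y /= ->.
Qed.

Lemma smooth_at_ext V n (M : manifoldType R n) (f g : V -> M) x :
  (forall y, f y = g y) -> smooth_at f x -> smooth_at g x.
Proof. by move=> /funext->. Qed.

Lemma smooth_at_comp V W {fd : fin_dim W} n (M : manifoldType R n)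
    (f : V -> W) (g : W -> M) x :
  smooth_near f x -> smooth_at g (f x) -> smooth_at (g \o f) x.
Proof.
move=> sf [gc gs]; split=> [|q dq].
  by apply: continuous_comp => //; exact: smooth_near_continuous.
exact: (smooth_near_comp sf (gs q dq)).
Qed.

Lemma smooth_at_cst V n (M : manifoldType R n) (p : M) (x : V) :
  smooth_at (fun=> p) x.
Proof. by split=> [|q _]; [exact: cst_continuous|exact: smooth_near_cst]. Qed.

Lemma cimg_chart n (M : manifoldType R n) (p q : M) :
  cdom (chart_at p) q -> cimg (chart_at p) (cmap (chart_at p) q).
Proof. by move=> dq; exists q. Qed.

Lemma cinv_cdom n (M : manifoldType R n) (p : M) y :
  cimg (chart_at p) y -> cdom (chart_at p) (cinv (chart_at p) y).
Proof. by move=> [q dq <-]; rewrite cmapK. Qed.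

Lemma cinvK n (M : manifoldType R n) (p : M) y :
  cimg (chart_at p) y -> cmap (chart_at p) (cinv (chart_at p) y) = y.
Proof. by move=> [q dq <-]; rewrite cmapK. Qed.

Lemma near_cimg n (M : manifoldType R n) (p : M) y :
  cimg (chart_at p) y -> \forall z \near y, cimg (chart_at p) z.
Proof. by move=> cy; apply: open_nbhs_nbhs; split=> //; exact: cimg_open. Qed.

(** This is the compatibility of charts. *)
Lemma smooth_at_cinv n (M : manifoldType R n) (p : M) y :
  cimg (chart_at p) y -> smooth_at (cinv (chart_at p)) y.
Proof.
move=> cy; split=> [|q dq]; first exact: cinv_continuous.
set U := cmap (chart_at p) @` (cdom (chart_at p) `&` cdom (chart_at q)).
have Uy : U y.
  by exists (cinv (chart_at p) y); [split=> //; exact: cinv_cdom|exact: cinvK].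
suff oU : open U by exact: (smooth_onP _ oU).1 (chart_at_compat p q) y Uy.
rewrite openE => _ [r [dp dr] <-].
have cr := cimg_chart dp.
have dq' : cdom (chart_at q) (cinv (chart_at p) (cmap (chart_at p) r)).
  by rewrite cmapK.
apply: filterS2 (near_cimg cr) (near_cdom (cinv_continuous cr) dq') => z cz dz.
by exists (cinv (chart_at p) z); [split=> //; exact: cinv_cdom|exact: cinvK].
Qed.

Lemma near_chartK V n (M : manifoldType R n) (f : V -> M) x q :
  {for x, continuous f} -> cdom (chart_at q) (f x) ->
  \forall y \near x, cinv (chart_at q) (cmap (chart_at q) (f y)) = f y.
Proof. by move=> fc /(near_cdom fc); apply: filterS => y; exact: cmapK. Qed.

Lemma smoothP m n (M : manifoldType R m) (N : manifoldType R n) (f : M -> N) :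
  smooth f <-> forall p y, cimg (chart_at p) y ->
                 smooth_at (f \o cinv (chart_at p)) y.
Proof.
have oc p : open (cimg (chart_at p : chart R m M)).
  exact: cimg_open.
by split=> h p; [exact: (smooth_intoP _ (oc p)).1 (h p)
                |apply/(smooth_intoP _ (oc p)); exact: h].
Qed.

Lemma smooth_at_map V m n (M : manifoldType R m) (N : manifoldType R n)
    (g : M -> N) (f : V -> M) x :
  smooth g -> smooth_at f x -> smooth_at (g \o f) x.
Proof.
move=> /smoothP sg [fc fs]; have dfx := chart_at_dom (f x).
apply: (@smooth_at_eq _ _ _
  ((g \o cinv (chart_at (f x))) \o (cmap (chart_at (f x)) \o f))).
  by apply: filterS (near_chartK fc dfx) => y /= ->.
by apply: smooth_at_comp; [exact: fs|apply: sg; exact: cimg_chart].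
Qed.

Lemma smooth_at_map2 V m n k (M : manifoldType R m) (N : manifoldType R n)
    (P : manifoldType R k) (g : M -> N -> P) (f : V -> M) (f' : V -> N) x :
  smooth2 g -> smooth_at f x -> smooth_at f' x ->
  smooth_at (fun y => g (f y) (f' y)) x.
Proof.
move=> sg [fc fs] [fc' fs'].
have dfx := chart_at_dom (f x); have dfx' := chart_at_dom (f' x).
pose c := chart_at (f x); pose c' := chart_at (f' x).
apply: (@smooth_at_eq _ _ _
  ((fun z => g (cinv c z.1) (cinv c' z.2)) \o (fun y => (cmap c (f y), cmap c' (f' y))))).
  by apply: filterS2 (near_chartK fc dfx) (near_chartK fc' dfx') => y /= -> ->.
apply: smooth_at_comp; first by apply: smooth_near_pair; [exact: fs|exact: fs'].
have oC : open (cimg c `*` cimg c').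
  rewrite openE => z [cz cz']; exists (cimg c, cimg c'); last by [].
  by split; exact: near_cimg.
apply: (smooth_intoP _ oC).1; first exact: sg.
by split; exact: cimg_chart.
Qed.

Lemma tderive_cst V n (M : manifoldType R n) (p : M) (x v : V) :
  tderive (fun=> p) x v = 0.
Proof. exact: derive_cst. Qed.

Lemma tderive_line V n (M : manifoldType R n) (f : V -> M) x v :
  tderive (fun s : R^o => f (x + s *: v)) 0 1 = tderive f x v.
Proof. by rewrite /tderive -[RHS]derive_line scale0r addr0. Qed.

(** The chain rule, in the charts at the images of [x]. *)
Lemma tderive_map V m n (M : manifoldType R m) (N : manifoldType R n)
    (g : M -> N) (f : V -> M) x v :
  smooth g -> smooth_at f x -> tderive (g \o f) x v = tmap g (f x) (tderive f x v).
Proof.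
move=> /smoothP sg [fc fs]; have dfx := chart_at_dom (f x).
rewrite /tmap /tderive [(g \o cinv _) _]/= cmapK//.
have [_ gs] := sg (f x) _ (cimg_chart dfx).
rewrite -derive_comp.
- apply: near_eq_derive; apply: filterS (near_chartK fc dfx) => y /= E.
  by rewrite E.
- by apply: smooth_near_differentiable; exact: fs.
- apply: smooth_near_differentiable; apply: gs.
  by rewrite /= cmapK//; exact: chart_at_dom.
Qed.

Lemma tmapN m n (M : manifoldType R m) (N : manifoldType R n)
    (g : M -> N) (p : M) u : smooth g -> tmap g p (- u) = - tmap g p u.
Proof.
move=> /smoothP sg; have dp := chart_at_dom p.
have [_ gs] := sg p _ (cimg_chart dp).
have /smooth_near_differentiable d := gs _ (chart_at_dom _).
by rewrite /tmap /tderive (deriveE _ d) (deriveE _ d) linearN.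
Qed.

End SmoothAt.

Section LieGroupCalculus.
Variables (R : realType) (n : nat) (G : lieGroupType R n).
Implicit Types V : normedModType R.

Let e : 'rV[R]_n := cmap (chart_at (1%g : G)) 1%g.

Let cimg_e : cimg (chart_at (1%g : G)) e.
Proof. exact/cimg_chart/chart_at_dom. Qed.

Let cinv_e : cinv (chart_at (1%g : G)) e = 1%g.
Proof. by rewrite cmapK//; exact: chart_at_dom. Qed.

Lemma smooth_at_mulg V (f g : V -> G) x :
  smooth_at f x -> smooth_at g x -> smooth_at (fun y => (f y * g y)%g) x.
Proof. exact: (smooth_at_map2 mulg_smooth). Qed.

Lemma smooth_at_invg V (f : V -> G) x :
  smooth_at f x -> smooth_at (fun y => (f y)^-1%g) x.
Proof. exact: (smooth_at_map invg_smooth). Qed.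

Lemma smooth_conjg (g : G) : smooth (fun h : G => (g * h * g^-1)%g).
Proof.
apply/smoothP => p y cy.
apply: smooth_at_mulg; last exact: smooth_at_cst.
by apply: smooth_at_mulg; [exact: smooth_at_cst|exact: smooth_at_cinv].
Qed.

(** In the chart at the unit, multiplication restricts to the identity on each
    of the two axes through the unit; by linearity its differential there is
    addition. *)
Lemma tderive_mulg V (f g : V -> G) x v :
  smooth_at f x -> smooth_at g x -> f x = 1%g -> g x = 1%g ->
  tderive (fun y => (f y * g y)%g) x v = tderive f x v + tderive g x v.
Proof.
move=> [fc fs] [gc gs] f1 g1; set c := chart_at (1%g : G).
have df : cdom c (f x) by rewrite f1; exact: chart_at_dom.
have dg : cdom c (g x) by rewrite g1; exact: chart_at_dom.
pose mu (z : 'rV[R]_n * 'rV[R]_n) : 'rV[R]_n := cmap c (cinv c z.1 * cinv c z.2)%g.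
have [_ smu] : smooth_at
    (fun z : 'rV[R]_n * 'rV[R]_n => (cinv c z.1 * cinv c z.2)%g) (e, e).
  apply: smooth_at_mulg.
    apply: (@smooth_at_comp _ _ _ _ _ _ fst); first exact: smooth_near_fst.
    exact: smooth_at_cinv.
  apply: (@smooth_at_comp _ _ _ _ _ _ snd); first exact: smooth_near_snd.
  exact: smooth_at_cinv.
have /smooth_near_differentiable dmu : smooth_near mu (e, e).
  by apply: smu; rewrite /= !cinv_e mulg1; exact: chart_at_dom.
have mu1 a : 'D_(a, 0) mu (e, e) = a.
  rewrite -derive_line.
  rewrite (@near_eq_derive _ _ _ _ (fun s : R^o => e + s *: a)).
    by rewrite (derive_line id); exact: derive_id.
  have : \forall s \near (0 : R^o), cimg c (e + s *: a).
    have ec : {for (0 : R^o), continuous (fun s : R^o => e + s *: a)}.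
      by apply: cvgD; [exact: cvg_cst|exact: scalel_continuous].
    apply: ec; rewrite /= scale0r addr0; exact: near_cimg.
  apply: filterS => s cs.
  by rewrite /mu /= scaler0 addr0 cinv_e mulg1 cinvK.
have mu2 a : 'D_(0, a) mu (e, e) = a.
  rewrite -derive_line.
  rewrite (@near_eq_derive _ _ _ _ (fun s : R^o => e + s *: a)).
    by rewrite (derive_line id); exact: derive_id.
  have : \forall s \near (0 : R^o), cimg c (e + s *: a).
    have ec : {for (0 : R^o), continuous (fun s : R^o => e + s *: a)}.
      by apply: cvgD; [exact: cvg_cst|exact: scalel_continuous].
    apply: ec; rewrite /= scale0r addr0; exact: near_cimg.
  apply: filterS => s cs.
  by rewrite /mu /= scaler0 addr0 cinv_e mul1g cinvK.
have dcf := smooth_near_differentiable (fs _ df).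
have dcg := smooth_near_differentiable (gs _ dg).
rewrite /tderive f1 g1 mulg1.
transitivity ('D_v (mu \o (fun y => (cmap c (f y), cmap c (g y)))) x).
  apply: near_eq_derive.
  apply: filterS2 (near_chartK fc df) (near_chartK gc dg) => y.
  by rewrite /mu /= => -> ->.
have dp := differentiable_pair dcf dcg.
have E : (cmap c (f x), cmap c (g x)) = (e, e) by rewrite f1 g1.
rewrite derive_comp ?E//.
have -> : 'D_v (fun y => (cmap c (f y), cmap c (g y))) x =
    ('D_v (cmap c \o f) x, 0) + (0, 'D_v (cmap c \o g) x).
  rewrite (deriveE _ dp) diff_pair// -[RHS]/(_ + _, _ + _) addr0 add0r.
  by rewrite (deriveE _ dcf) (deriveE _ dcg).
by rewrite (deriveE _ dmu) linearD -!(deriveE _ dmu) mu1 mu2.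
Qed.

Lemma tderive_invg V (f : V -> G) x v :
  smooth_at f x -> f x = 1%g ->
  tderive (fun y => (f y)^-1%g) x v = - tderive f x v.
Proof.
move=> sf f1; apply/eqP; rewrite -addr_eq0 addrC; apply/eqP.
rewrite -tderive_mulg//; last by rewrite f1 invg1.
  rewrite (_ : (fun y => _) = fun=> 1%g) ?tderive_cst//.
  by apply/funext => y; rewrite mulgV.
exact: smooth_at_invg.
Qed.

Lemma tderive_conjg V (f : V -> G) x v g :
  smooth_at f x -> f x = 1%g ->
  tderive (fun y => (g * f y * g^-1)%g) x v = Ad g (tderive f x v).
Proof. by move=> sf f1; rewrite (tderive_map _ (smooth_conjg g) sf) f1. Qed.

(** [Ad (cinv c y) eta] is the partial derivative along [(0, eta)] of the smooth
    map that sends [(y, z)] to the conjugate of [z] by [y] in coordinates; a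
    directional derivative of a smooth map is smooth. *)
Lemma smooth_near_Ad (eta : 'rV[R]_n) :
  smooth_near (fun y => Ad (cinv (chart_at (1%g : G)) y) eta) e.
Proof.
set c := chart_at (1%g : G).
pose Phi (z : 'rV[R]_n * 'rV[R]_n) : 'rV[R]_n :=
  cmap c (cinv c z.1 * cinv c z.2 * (cinv c z.1)^-1)%g.
have s1 : smooth_at (fun z : 'rV[R]_n * 'rV[R]_n => cinv c z.1) (e, e).
  apply: (@smooth_at_comp _ _ _ _ _ _ fst); first exact: smooth_near_fst.
  exact: smooth_at_cinv.
have s2 : smooth_at (fun z : 'rV[R]_n * 'rV[R]_n => cinv c z.2) (e, e).
  apply: (@smooth_at_comp _ _ _ _ _ _ snd); first exact: smooth_near_snd.
  exact: smooth_at_cinv.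
have [_ sm] := smooth_at_mulg (smooth_at_mulg s1 s2) (smooth_at_invg s1).
have sPhi : smooth_near Phi (e, e).
  by apply: sm; rewrite /= cinv_e invg1 !mulg1; exact: chart_at_dom.
rewrite (_ : (fun y => _) = ('D_(0, eta) Phi) \o (fun y => (y, e))).
  apply: smooth_near_comp; last exact: smooth_near_derive.
  by apply: smooth_near_pair; [exact: smooth_near_id|exact: smooth_near_cst].
apply/funext => y /=; rewrite /Ad /tmap /tderive /= cmapK ?mulg1 ?mulgV; last first.
  exact: chart_at_dom.
rewrite -[LHS]derive_line -[RHS]derive_line.
have E (s : R) : (y, e) + s *: (0 : 'rV[R]_n, eta) = (y, e + s *: eta).
  by rewrite -[LHS]/(y + s *: 0, _) scaler0 addr0.
apply: (f_equal (fun f : R^o -> 'rV[R]_n => 'D_(1 : R^o) f (0 : R^o))).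
by apply/funext => s; rewrite E.
Qed.

End LieGroupCalculus.

(** * Symmetry of mixed derivatives *)

Section Schwarz.
Variable R : realType.
Implicit Types V W : normedModType R.

Lemma is_derive_line V W (f : V -> W) (a u : V) (s : R) :
  differentiable f (a + s *: u) ->
  is_derive (s : R^o) (1 : R^o) (fun r : R^o => f (a + r *: u)) ('D_u f (a + s *: u)).
Proof.
move=> df.
have E : 'D_1 (fun r : R^o => f (a + r *: u)) s = 'D_u f (a + s *: u).
  rewrite -[RHS]derive_line /derive.
  set g1 := fun h => h^-1 *: _; set g2 := fun h => h^-1 *: _.
  suff -> : g1 = g2 by [].
  apply/funext => h; rewrite /g1 /g2 /= addr0 scale0r addr0.
  by rewrite [_%:A]mulr1 scalerDl -addrA [s *: u + _]addrC.
apply: DeriveDef => //; apply/derivable1P.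
have /derivable1P H := @diff_derivable _ _ _ f (a + s *: u) u df.
have F : (fun h : R^o => f (h *: u + (a + s *: u))) =
    (fun h : R^o => f (a + (h *: (1 : R^o) + s) *: u)).
  by apply/funext => h; rewrite [_%:A]mulr1 scalerDl addrCA.
exact: (eq_ind _ (fun k : R^o -> W => derivable k (0 : R^o) (1 : R^o)) H _ F).
Qed.

Lemma mean_value (g dg : R -> R) (h : R) : 0 < h ->
  (forall s : R, 0 <= s <= h ->
     is_derive (s : R^o) (1 : R^o) (g : R^o -> R^o) (dg s)) ->
  exists a, 0 <= a <= h /\ g h - g 0 = dg a * h.
Proof.
move=> h0 gD.
have d1 x : x \in `]0, h[ -> is_derive x 1 g (dg x).
  by rewrite in_itv => /andP[x0 xh]; apply: gD; rewrite !ltW.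
have d2 : {within `[0, h], continuous g}.
  apply: derivable_within_continuous => x; rewrite in_itv => xh.
  exact: (@ex_derive _ _ _ _ _ _ _ (gD x xh)).
have [a + E] := MVT h0 d1 d2; rewrite in_itv => /andP[a0 ah].
by exists a; rewrite E subr0 !ltW.
Qed.

(** Two applications of the mean value theorem, first along [u] and then along
    [v].  The second difference is symmetric in [u] and [v], which is what the
    mixed partial derivatives inherit. *)
Lemma second_difference V (f : V -> R^o) (x u v : V) (h : R) : 0 < h ->
  (forall a b, 0 <= a <= h -> 0 <= b <= h -> smooth_near f (x + a *: u + b *: v)) ->
  exists a b, [/\ 0 <= a <= h, 0 <= b <= h &
    f (x + h *: u + h *: v) - f (x + h *: u) - (f (x + h *: v) - f x) =
    'D_v ('D_u f) (x + a *: u + b *: v) * h * h :> R].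
Proof.
move=> h0 sf; have hh : 0 <= h <= h by apply/andP; split=> //; exact: ltW.
have h00 : (0 : R) <= 0 <= h by apply/andP; split=> //; exact: ltW.
pose g (s : R) : R := f (x + h *: v + s *: u) - f (x + s *: u).
pose dg (s : R) : R := 'D_u f (x + h *: v + s *: u) - 'D_u f (x + s *: u).
have dgE (s : R) : 0 <= s <= h -> is_derive (s : R^o) (1 : R^o) (g : R^o -> R^o) (dg s).
  move=> sh; apply: is_deriveB; apply: is_derive_line.
    by apply: smooth_near_differentiable; rewrite addrAC; exact: sf.
  by apply: smooth_near_differentiable; have := sf s 0 sh h00; rewrite scale0r addr0.
have [a [ah Ea]] := mean_value h0 dgE.
pose k (s : R) : R := 'D_u f (x + a *: u + s *: v).
pose dk (s : R) : R := 'D_v ('D_u f) (x + a *: u + s *: v).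
have dkE (s : R) : 0 <= s <= h -> is_derive (s : R^o) (1 : R^o) (k : R^o -> R^o) (dk s).
  move=> sh; apply: is_derive_line.
  by apply: smooth_near_differentiable; apply: smooth_near_derive; exact: sf.
have [b [bh Eb]] := mean_value h0 dkE.
exists a, b; split=> //.
move: Eb Ea; rewrite /g /k /dg /dk !scale0r !addr0 => Eb.
rewrite [x + h *: v + a *: u]addrAC Eb => <-.
by rewrite [x + h *: v + h *: u]addrAC; ring.
Qed.

(** For small [h] the second difference, divided by [h * h], is a value of either
    mixed derivative at a point close to [x]; both are continuous at [x]. *)
Lemma schwarz_real V (f : V -> R^o) (x u v : V) :
  smooth_near f x -> 'D_u ('D_v f) x = 'D_v ('D_u f) x.
Proof.
move=> sf; apply/eqP; rewrite -subr_eq0 -normr_le0; apply/ler_addgt0Pl => eps eps0.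
rewrite addr0.
have c1 := smooth_near_continuous (smooth_near_derive u (smooth_near_derive v sf)).
have c2 := smooth_near_continuous (smooth_near_derive v (smooth_near_derive u sf)).
have e2 : 0 < eps / 2 by rewrite divr_gt0.
have n1 : \forall y \near x, `|'D_u ('D_v f) x - 'D_u ('D_v f) y| < eps / 2.
  by move: c1 => /cvgrPdist_lt; apply.
have n2 : \forall y \near x, `|'D_v ('D_u f) x - 'D_v ('D_u f) y| < eps / 2.
  by move: c2 => /cvgrPdist_lt; apply.
have /nbhs_ballP[r /= r0 B] : \forall y \near x, [/\ smooth_near f y,
    `|'D_u ('D_v f) x - 'D_u ('D_v f) y| < eps / 2 &
    `|'D_v ('D_u f) x - 'D_v ('D_u f) y| < eps / 2].
  by apply: filterS3 (smooth_near_near sf) n1 n2.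
(* This [h] keeps the parallelogram spanned by [h u] and [h v] in the ball. *)
pose h := r / (2 * (`|u| + `|v| + 1)).
have d0 : 0 < `|u| + `|v| + 1 by rewrite ltr_wpDl// addr_ge0.
have h0 : 0 < h by rewrite divr_gt0// mulr_gt0.
have Bh a b : 0 <= a <= h -> 0 <= b <= h -> ball x r (x + a *: u + b *: v).
  move=> /andP[a0 ah] /andP[b0 bh]; rewrite -ball_normE /ball_ /=.
  rewrite -addrA opprD addrA subrr sub0r normrN.
  apply: le_lt_trans (ler_normD _ _) _; rewrite !normrZ !ger0_norm//.
  apply: (@le_lt_trans _ _ (h * `|u| + h * `|v|)); first by rewrite lerD// ler_wpM2r.
  have -> : r = h * (2 * (`|u| + `|v| + 1)).
    by rewrite /h divfK// gt_eqF// mulr_gt0.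
  have := normr_ge0 u; have := normr_ge0 v.
  by rewrite -mulrDr ltr_pM2l//; lra.
have [a [b [ah bh E]]] := second_difference h0
  (fun a b ah bh => let: And3 h _ _ := B _ (Bh a b ah bh) in h).
have Bh' a' b' : 0 <= a' <= h -> 0 <= b' <= h -> ball x r (x + a' *: v + b' *: u).
  by move=> ha hb; rewrite addrAC; exact: Bh.
have [a' [b' [ah' bh' E']]] :=
  second_difference h0 (fun a b ah bh => let: And3 h _ _ := B _ (Bh' a b ah bh) in h).
have {E E'} E : 'D_v ('D_u f) (x + a *: u + b *: v) =
    'D_u ('D_v f) (x + a' *: v + b' *: u).
  have hn0 : h != 0 by rewrite gt_eqF.
  have key (c d : R) : c * h * h = d * h * h -> c = d.
    by move=> /(mulIf hn0)/(mulIf hn0).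
  apply: key; apply: etrans (esym E) _; apply: etrans _ E'.
  rewrite [x + h *: v + h *: u]addrAC.
  have alg (p q w z : R) : p - q - (w - z) = p - w - (q - z) by ring.
  exact: alg.
have [_ _ H2] := B _ (Bh a b ah bh).
have [_ H1 _] := B _ (Bh' a' b' ah' bh').
have close (p q w : R) : `|p - w| < eps / 2 -> `|q - w| < eps / 2 -> `|p - q| <= eps.
  move=> pw qw; have -> : p - q = (p - w) - (q - w) by rewrite opprB addrA subrK.
  apply: ltW; rewrite (splitr eps).
  by apply: le_lt_trans (ler_normB _ _) _; exact: ltrD.
by move: H2; rewrite E; exact: close.
Qed.

Lemma schwarz V n (f : V -> 'rV[R]_n) (x u v : V) :
  smooth_near f x -> 'D_u ('D_v f) x = 'D_v ('D_u f) x.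
Proof.
move=> sf; apply/rowP => i.
have lin : linear (fun y : 'rV[R]_n => y ord0 i : R^o).
  by move=> a y z; rewrite !mxE.
pose l : {linear 'rV[R]_n -> R^o} :=
  HB.pack (fun y : 'rV[R]_n => y ord0 i : R^o) (GRing.isLinear.Build _ _ _ _ _ lin).
have lc : continuous l by exact: coord_continuous.
have E a b : l ('D_a ('D_b f) x) = 'D_a ('D_b (l \o f)) x.
  rewrite -derive_lin//; last first.
    by apply: smooth_near_differentiable; exact: smooth_near_derive.
  apply: near_eq_derive; apply: filterS (smooth_near_near sf) => y sfy /=.
  exact: (esym (derive_lin b lc (smooth_near_differentiable sfy))).
have slf : smooth_near (l \o f) x.
  by apply: smooth_near_comp => //; exact: smooth_near_lin.
exact: etrans (E u v) (etrans (schwarz_real u v slf) (esym (E v u))).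
Qed.

End Schwarz.

(** * Rectangles in the plane as bigons *)

Section StandardSquares.
Variable R : realType.
Implicit Types V : normedModType R.

Lemma smooth_near_step_comp V (c : V -> R^o) x :
  smooth_near c x -> smooth_near (fun y => step (c y) : R^o) x.
Proof. by move=> sc; exact: (smooth_near_comp sc (smooth_near_step _)). Qed.

(** The progress along one side of a rectangle.  At [u = 0] the side is
    traversed in the second half of the time, at [u = 1] in the first half, so
    that interpolating in [u] exchanges the order of two sides. *)
Definition bend (u tau : R) : R :=
  (1 - step u) * step (2 * tau - 1) + step u * step (2 * tau).

(** The two sides are bent in opposite senses: the boundary paths at [u = 0]
    and [u = 1] are the two ways around the rectangle. *)
Definition square (s t u tau : R) : R^o * R^o :=
  (s * bend u tau, t * bend (1 - u) tau).

Lemma smooth_near_bend V (u tau : V -> R^o) x :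
  smooth_near u x -> smooth_near tau x ->
  smooth_near (fun y => bend (u y) (tau y) : R^o) x.
Proof.
move=> su stau; have s2 : smooth_near (fun y => 2 * tau y : R^o) x.
  by apply: smooth_nearM => //; exact: smooth_near_cst.
apply: smooth_nearD; apply: smooth_nearM.
- apply: smooth_nearB; first exact: smooth_near_cst.
  exact: smooth_near_step_comp.
- apply: smooth_near_step_comp; apply: smooth_nearB => //.
  exact: smooth_near_cst.
- exact: smooth_near_step_comp.
- exact: smooth_near_step_comp.
Qed.

Lemma smooth_near_square V (s t u tau : V -> R^o) x :
  smooth_near s x -> smooth_near t x -> smooth_near u x -> smooth_near tau x ->
  smooth_near (fun y => square (s y) (t y) (u y) (tau y)) x.
Proof.
move=> ss st su stau; apply: smooth_near_pair.
  by apply: smooth_nearM => //; exact: smooth_near_bend.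
apply: smooth_nearM => //; apply: smooth_near_bend => //.
by apply: smooth_nearB => //; exact: smooth_near_cst.
Qed.

Lemma bend_start (u tau : R) : tau < 8^-1 -> bend u tau = 0.
Proof.
move=> h; rewrite /bend (@step0 _ (2 * tau)) ?(@step0 _ (2 * tau - 1)).
  by rewrite ?mulr0 ?addr0.
all: lra.
Qed.

Lemma bend_end (u tau : R) : 1 - 8^-1 < tau -> bend u tau = 1.
Proof.
move=> h; rewrite /bend (@step1 _ (2 * tau)) ?(@step1 _ (2 * tau - 1)).
  by rewrite ?mulr1 ?subrK.
all: lra.
Qed.

Lemma bend_src (u tau : R) : u < 8^-1 -> bend u tau = bend 0 tau.
Proof. by move=> h; rewrite /bend !(@step0 _ u) ?(@step0 _ 0)//; lra. Qed.

Lemma bend_tgt (u tau : R) : 1 - 8^-1 < u -> bend u tau = bend 1 tau.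
Proof. by move=> h; rewrite /bend !(@step1 _ u) ?(@step1 _ 1)//; lra. Qed.

Lemma bend0 tau : bend 0 tau = step (2 * tau - 1).
Proof. by rewrite /bend (@step0 _ 0) ?subr0 ?mul1r ?mul0r ?addr0//; lra. Qed.

Lemma bend1 tau : bend 1 tau = step (2 * tau).
Proof. by rewrite /bend (@step1 _ 1) ?subrr ?mul1r ?mul0r ?add0r//; lra. Qed.

Lemma square_sitting (s t u tau : R) :
  [/\ tau < 8^-1 -> square s t u tau = square s t 0 0,
      1 - 8^-1 < tau -> square s t u tau = square s t 0 1,
      u < 8^-1 -> square s t u tau = square s t 0 tau
    & 1 - 8^-1 < u -> square s t u tau = square s t 1 tau].
Proof.
split=> h; rewrite /square.
- by rewrite !(@bend_start _ tau)// !(@bend_start _ 0)//; lra.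
- by rewrite !(@bend_end _ tau)// !(@bend_end _ 1)//; lra.
- rewrite (bend_src _ h) [bend (1 - u) _]bend_tgt ?[bend (1 - 0) _]bend_tgt//; lra.
- rewrite (bend_tgt _ h) [bend (1 - u) _]bend_src ?[bend (1 - 1) _]bend_src//; lra.
Qed.

Lemma line_path_step (a : R) : Defs.line_path 0 a (fun tau => step tau * a).
Proof.
split.
- apply/(smooth_onP _ (@openT R^o)) => y _.
  by apply: smooth_nearM; [exact: smooth_near_step|exact: smooth_near_cst].
- exists 4^-1; split; [lra|lra|move=> u; split=> h].
    by rewrite !step0//; lra.
  by rewrite !step1//; lra.
- by rewrite step0 ?mul0r//; lra.
- by rewrite step1 ?mul1r//; lra.
Qed.

Lemma square_src (s t tau : R) :
  square s t 0 tau = (s * step (2 * tau - 1), t * step (2 * tau)).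
Proof. by rewrite /square bend0 subr0 bend1. Qed.

Lemma square_tgt (s t tau : R) :
  square s t 1 tau = (s * step (2 * tau), t * step (2 * tau - 1)).
Proof. by rewrite /square bend1 subrr bend0. Qed.

(** On each half of the time, one of the two coordinates sits still, since
    [step] is constant outside the unit interval. *)
Lemma square_bigonP (s t : R) : square_bigon s t (square s t).
Proof.
split.
- apply/(smooth_onP _ (@openT (R^o * R^o)%type)) => y _.
  by apply: smooth_near_square;
    by [exact: smooth_near_cst|exact: smooth_near_fst|exact: smooth_near_snd].
- exists 8^-1; split; [lra|lra|exact: square_sitting].
exists (@step R).
  by have := line_path_step 1; under eq_fun do rewrite mulr1.
have pairE (a b c d : R^o) (r : R) : (a, b) + r *: ((c, d) - (a, b)) =
    (a + r * (c - a), b + r * (d - b)) by [].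
have -> : (0 : R^o * R^o) = (0, 0) by [].
split; apply/funext => tau; rewrite ?square_src ?square_tgt /path_comp /segment.
  case: ifPn => [h|]; rewrite pairE.
    by rewrite (@step0 _ (2 * tau - 1)); [congr (_, _); ring|lra].
  rewrite -ltNge => h.
  by rewrite (@step1 _ (2 * tau)); [congr (_, _); ring|lra].
case: ifPn => [h|]; rewrite pairE.
  by rewrite (@step0 _ (2 * tau - 1)); [congr (_, _); ring|lra].
rewrite -ltNge => h.
by rewrite (@step1 _ (2 * tau)); [congr (_, _); ring|lra].
Qed.

End StandardSquares.

(** * Thin maps and smooth families *)

Section RankOfCurves.
Variables (R : realType) (n : nat) (X : manifoldType R n).

(** A map that factors through a line has all its derivatives proportional to
    the velocity of the curve. *)
Lemma rank_le_curve k (V : normedModType R) (c : R^o -> X) (q : V -> R^o) z :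
  (0 < k)%N -> smooth_near q z -> smooth_at c (q z) -> rank_le k (c \o q) z.
Proof.
case: k => // k _ sq [cc cs]; have dc := cs _ (chart_at_dom _).
have dq := smooth_near_differentiable sq.
pose P : 'M[R]_(k.+1, n) := \matrix_(i, j) tderive c (q z) 1 0 j.
have rowP0 : row 0 P = tderive c (q z) 1 by apply/rowP => j; rewrite !mxE.
exists P => v.
have -> : tderive (c \o q) z v = ('D_v q z : R) *: tderive c (q z) 1.
  have d := smooth_near_differentiable dc.
  rewrite /tderive -[LHS]/('D_v ((cmap (chart_at (c (q z))) \o c) \o q) z).
  rewrite (derive_comp v dq d) (deriveE _ d) (deriveE _ d).
  have {1}-> : 'D_v q z = ('D_v q z : R) *: (1 : R^o) by rewrite [RHS]mulr1.
  exact: linearZ.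
by apply: scalemx_sub; rewrite -rowP0; exact: row_sub.
Qed.

End RankOfCurves.

Section Plots.
Variables (R : realType) (n m k : nat) (X : manifoldType R n).
Variables (G : lieGroupType R m) (H : lieGroupType R k).
Variables (t : H -> G) (alpha : G -> H -> H).
Variables (F1 : (R -> X) -> G) (F2 : (R -> R -> X) -> G * H).
Hypothesis F : smooth_2functor t alpha F1 F2.

Let pair_row (z : R^o * R^o) : 'rV[R]_2 :=
  (z.1 : R) *: delta_mx 0 0 + (z.2 : R) *: delta_mx 0 1.

Let pair_row0 z : pair_row z 0 0 = z.1.
Proof. by rewrite !mxE /= mulr1 mulr0 addr0. Qed.

Let pair_row1 z : pair_row z 0 1 = z.2.
Proof. by rewrite !mxE /= mulr1 mulr0 add0r. Qed.

Let smooth_near_pair_row z : smooth_near pair_row z.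
Proof.
apply: smooth_nearD; apply: smooth_nearZ; try exact: smooth_near_cst.
  exact: smooth_near_fst.
exact: smooth_near_snd.
Qed.

Let smooth_near_coord (V : normedModType R) (i : 'I_2) (f : V -> 'rV[R]_2) x :
  smooth_near f x -> smooth_near (fun y => f y 0 i : R^o) x.
Proof.
have lin : linear (fun y : 'rV[R]_2 => y 0 i : R^o) by move=> a y z; rewrite !mxE.
pose l : {linear 'rV[R]_2 -> R^o} :=
  HB.pack (fun y : 'rV[R]_2 => y 0 i : R^o) (GRing.isLinear.Build _ _ _ _ _ lin).
move=> sf; apply: (smooth_near_comp sf (@smooth_near_lin _ _ _ l _ _)).
exact: coord_continuous.
Qed.

(** Plots are indexed by row vectors, while parameters come here in pairs; the
    two are exchanged by linear maps. *)
Lemma smooth_at_F1 (c : R -> R -> R -> X) :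
  (forall a b, is_path (c a b)) ->
  (forall z, smooth_at (fun z : R^o * R^o * R^o => c z.1.1 z.1.2 z.2) z) ->
  forall z, smooth_at (fun z : R^o * R^o => F1 (c z.1 z.2)) z.
Proof.
move=> pc sc z; pose d (u : 'rV[R]_2) := c (u 0 0) (u 0 1).
have plot : is_path_plot setT d.
  split=> [|u _|]; [exact: openT|exact: pc|].
  rewrite setXTT; apply/(smooth_intoP _ (@openT _)) => y _.
  apply: (@smooth_at_comp _ _ _ _ _ _ (fun y : 'rV[R]_2 * R^o =>
    ((y.1 0 0 : R^o, y.1 0 1 : R^o), y.2))
    (fun z : R^o * R^o * R^o => c z.1.1 z.1.2 z.2)); last exact: sc.
  have s1 := smooth_near_fst y.
  apply: smooth_near_pair; last exact: smooth_near_snd.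
  by apply: smooth_near_pair; exact: smooth_near_coord.
have /(smooth_intoP _ (@openT _)) sF := f1_smooth F plot.
have sFz := smooth_at_comp (fd := fin_dim_rV R 2)
  (smooth_near_pair_row z) (sF _ I).
apply: smooth_at_ext sFz => y /=.
by rewrite /d pair_row0 pair_row1.
Qed.

Lemma smooth_at_F2 (c : R -> R -> R -> R -> X) :
  (forall a b, is_bigon (c a b)) ->
  (forall z, smooth_at
     (fun z : R^o * R^o * (R^o * R^o) => c z.1.1 z.1.2 z.2.1 z.2.2) z) ->
  forall z, smooth_at (fun z : R^o * R^o => (F2 (c z.1 z.2)).2) z.
Proof.
move=> pc sc z; pose d (u : 'rV[R]_2) := c (u 0 0) (u 0 1).
have plot : is_bigon_plot setT d.
  split=> [|u _|]; [exact: openT|exact: pc|].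
  rewrite setXTT; apply/(smooth_intoP _ (@openT _)) => y _.
  apply: (@smooth_at_comp _ _ _ _ _ _ (fun y : 'rV[R]_2 * (R^o * R^o) =>
    ((y.1 0 0 : R^o, y.1 0 1 : R^o), y.2))
    (fun z : R^o * R^o * (R^o * R^o) => c z.1.1 z.1.2 z.2.1 z.2.2)); last exact: sc.
  have s1 := smooth_near_fst y.
  apply: smooth_near_pair; last exact: smooth_near_snd.
  by apply: smooth_near_pair; exact: smooth_near_coord.
have /(smooth_intoP _ (@openT _)) sF := (f2_smooth F plot).2.
have sFz := smooth_at_comp (fd := fin_dim_rV R 2)
  (smooth_near_pair_row z) (sF _ I).
apply: smooth_at_ext sFz => y /=.
by rewrite /d pair_row0 pair_row1.
Qed.

End Plots.

(** * Holonomy around rectangles *)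

Section Plane.
Variables (R : realType) (n m k : nat) (X : manifoldType R n).
Variables (G : lieGroupType R m) (H : lieGroupType R k).
Variables (t : H -> G) (alpha : G -> H -> H).
Variables (F1 : (R -> X) -> G) (F2 : (R -> R -> X) -> G * H).
Hypothesis F : smooth_2functor t alpha F1 F2.
Variable Gamma : R^o * R^o -> X.
Hypothesis sGamma : forall z, smooth_at Gamma z.

(** In [hor b a] the height [b] comes first, so that [hor b] is the family of
    holonomies along a fixed line. *)
Definition hor (b a : R) : G := F1 (fun tau => Gamma (step tau * a, b)).
Definition ver (a b : R) : G := F1 (fun tau => Gamma (a, step tau * b)).
Definition sqr (a b : R) : H := (F2 (fun u tau => Gamma (square a b u tau))).2.

Lemma is_path_plane (c : R -> R^o * R^o) :
  (forall y : R^o, smooth_near (c : R^o -> R^o * R^o) y) -> sitting1 c ->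
  is_path (fun tau => Gamma (c tau)).
Proof.
move=> sc [e [e0 e1 sit]]; split.
  apply/(smooth_intoP _ (@openT R^o)) => y _.
  exact: (@smooth_at_comp _ _ _ _ _ _ (c : R^o -> R^o * R^o) Gamma).
by exists e; split=> // tau; split=> h; congr Gamma; apply sit.
Qed.

Lemma sitting_step (T : Type) (c : R -> T) :
  sitting1 (fun tau : R => c (step tau)).
Proof.
exists 4^-1; split; [lra|lra|move=> u; split=> h; congr c].
  by rewrite !step0//; lra.
by rewrite !step1//; lra.
Qed.

Lemma is_path_hor b a : is_path (fun tau => Gamma (step tau * a, b)).
Proof.
apply: is_path_plane; last exact: (@sitting_step _ (fun r => (r * a, b))).
move=> y; apply: smooth_near_pair; last exact: smooth_near_cst.
by apply: smooth_nearM; [exact: smooth_near_step|exact: smooth_near_cst].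
Qed.

Lemma is_path_ver a b : is_path (fun tau => Gamma (a, step tau * b)).
Proof.
apply: is_path_plane; last exact: (@sitting_step _ (fun r => (a, r * b))).
move=> y; apply: smooth_near_pair; first exact: smooth_near_cst.
by apply: smooth_nearM; [exact: smooth_near_step|exact: smooth_near_cst].
Qed.

Lemma is_bigon_square a b : is_bigon (fun u tau => Gamma (square a b u tau)).
Proof.
split.
  apply/(smooth_intoP _ (@openT (R^o * R^o)%type)) => y _.
  apply: (@smooth_at_comp _ _ _ _ _ _
    (fun z : R^o * R^o => square a b z.1 z.2) Gamma); last exact: sGamma.
  by apply: smooth_near_square;
    by [exact: smooth_near_cst|exact: smooth_near_fst|exact: smooth_near_snd].
exists 8^-1; split; [lra|lra|move=> u tau].
by have [h1 h2 h3 h4] := square_sitting a b u tau; split=> h; congr Gamma; auto.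
Qed.

Lemma smooth_at_hor z : smooth_at (fun z : R^o * R^o => hor z.1 z.2) z.
Proof.
apply: (smooth_at_F1 F (c := fun b a tau => Gamma (step tau * a, b))).
  by move=> b a; exact: is_path_hor.
move=> y; apply: (@smooth_at_comp _ _ _ _ _ _
  (fun z : R^o * R^o * R^o => (step z.2 * z.1.2 : R^o, z.1.1)) Gamma); last exact: sGamma.
have s1 := smooth_near_fst y; have s2 := smooth_near_snd y.
apply: smooth_near_pair.
  apply: smooth_nearM; first exact: smooth_near_step_comp.
  exact: (smooth_near_comp s1 (smooth_near_snd _)).
exact: (smooth_near_comp s1 (smooth_near_fst _)).
Qed.

Lemma smooth_at_ver z : smooth_at (fun z : R^o * R^o => ver z.1 z.2) z.
Proof.
apply: (smooth_at_F1 F (c := fun a b tau => Gamma (a, step tau * b))).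
  by move=> a b; exact: is_path_ver.
move=> y; apply: (@smooth_at_comp _ _ _ _ _ _
  (fun z : R^o * R^o * R^o => (z.1.1, step z.2 * z.1.2 : R^o)) Gamma); last exact: sGamma.
have s1 := smooth_near_fst y; have s2 := smooth_near_snd y.
apply: smooth_near_pair; first exact: (smooth_near_comp s1 (smooth_near_fst _)).
apply: smooth_nearM; first exact: smooth_near_step_comp.
exact: (smooth_near_comp s1 (smooth_near_snd _)).
Qed.

Lemma smooth_at_sqr z : smooth_at (fun z : R^o * R^o => sqr z.1 z.2) z.
Proof.
apply: (smooth_at_F2 F (c := fun a b u tau => Gamma (square a b u tau))).
  by move=> a b; exact: is_bigon_square.
move=> y; apply: (@smooth_at_comp _ _ _ _ _ _
  (fun z : R^o * R^o * (R^o * R^o) => square z.1.1 z.1.2 z.2.1 z.2.2) Gamma);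
  last exact: sGamma.
have s1 := smooth_near_fst y; have s2 := smooth_near_snd y.
apply: smooth_near_square.
- exact: (smooth_near_comp s1 (smooth_near_fst _)).
- exact: (smooth_near_comp s1 (smooth_near_snd _)).
- exact: (smooth_near_comp s2 (smooth_near_fst _)).
- exact: (smooth_near_comp s2 (smooth_near_snd _)).
Qed.

Lemma F1_square_src a b :
  F1 (fun tau => Gamma (square a b 0 tau)) = (hor b a * ver 0 b)%g.
Proof.
rewrite -(f1_comp F (is_path_ver 0 b) (is_path_hor b a)).
  congr F1; apply/funext => tau; rewrite square_src /path_comp.
  case: ifPn => [h|].
    by rewrite (@step0 _ (2 * tau - 1)); [congr (Gamma (_, _)); ring|lra].
  rewrite -ltNge => h.
  by rewrite (@step1 _ (2 * tau)); [congr (Gamma (_, _)); ring|lra].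
by rewrite (@step1 _ 1) ?(@step0 _ 0) ?mul0r ?mul1r//; lra.
Qed.

Lemma F1_square_tgt a b :
  F1 (fun tau => Gamma (square a b 1 tau)) = (ver a b * hor 0 a)%g.
Proof.
rewrite -(f1_comp F (is_path_hor 0 a) (is_path_ver a b)).
  congr F1; apply/funext => tau; rewrite square_tgt /path_comp.
  case: ifPn => [h|].
    by rewrite (@step0 _ (2 * tau - 1)); [congr (Gamma (_, _)); ring|lra].
  rewrite -ltNge => h.
  by rewrite (@step1 _ (2 * tau)); [congr (Gamma (_, _)); ring|lra].
by rewrite (@step1 _ 1) ?(@step0 _ 0) ?mul0r ?mul1r//; lra.
Qed.

(** The target condition on the 2-morphism of the rectangle. *)
Lemma t_sqr a b : t (sqr a b) = (ver a b * hor 0 a * (hor b a * ver 0 b)^-1)%g.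
Proof.
have bs := is_bigon_square a b.
have := f2_tgt F bs; rewrite /bg_tgt -/(bg_src _) (f2_src F bs).
by rewrite F1_square_src F1_square_tgt => <-; rewrite mulgK.
Qed.

(** A rectangle of height [0] lies over a line, on which any two maps are
    joined by the straight homotopy; this one has rank at most [1] everywhere,
    and ends at an identity bigon. *)
Lemma sqr0 a : sqr a 0 = 1%g.
Proof.
pose S u tau := Gamma (square a 0 u tau); pose S' (u : R) := S 0.
have pS : is_path (S 0).
  apply: (is_path_plane (c := square a 0 0)).
    move=> y; apply: smooth_near_square;
      by [exact: smooth_near_cst|exact: smooth_near_id].
  exists 8^-1; split; [lra|lra|move=> tau].
  by have [h1 h2 _ _] := square_sitting a 0 0 tau; split.
have bS' : is_bigon S'.
  have [ps [e [e0 e1 sit]]] := pS; split; last first.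
    exists e; split=> // u tau; split=> //; first exact: (sit tau).1.
    exact: (sit tau).2.
  apply/(smooth_intoP _ (@openT (R^o * R^o)%type)) => y _.
  apply: (@smooth_at_comp _ _ _ _ _ _ snd (S 0 : R^o -> X)).
    exact: smooth_near_snd.
  exact: ((smooth_intoP _ (@openT R^o)).1 ps).
suff : thin_bigon S S'.
  move=> /(f2_thin F (is_bigon_square a 0) bS'); rewrite /sqr => ->.
  by rewrite (f2_id F pS).
(* The straight homotopy, as the first coordinate of a map into the line. *)
pose q (r u tau : R) : R := (1 - step r) * (a * bend u tau) + step r * (a * bend 0 tau).
pose h r u tau := Gamma (q r u tau, 0).
have SE u tau : S u tau = Gamma (a * bend u tau, 0) by rewrite /S /square mul0r.
have sq z : smooth_near (fun z : R^o * R^o * R^o => q z.1.1 z.1.2 z.2 : R^o) z.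
  have s1 := smooth_near_fst z; have s3 := smooth_near_snd z.
  have s11 : smooth_near (fun z : R^o * R^o * R^o => z.1.1) z.
    exact: (smooth_near_comp s1 (smooth_near_fst _)).
  have s12 : smooth_near (fun z : R^o * R^o * R^o => z.1.2) z.
    exact: (smooth_near_comp s1 (smooth_near_snd _)).
  have sr := smooth_near_step_comp s11.
  have sb := smooth_near_bend s12 s3.
  have sb0 := smooth_near_bend (smooth_near_cst (0 : R^o) z) s3.
  apply: smooth_nearD; apply: smooth_nearM => //.
  - by apply: smooth_nearB => //; exact: smooth_near_cst.
  - by apply: smooth_nearM => //; exact: smooth_near_cst.
  - by apply: smooth_nearM => //; exact: smooth_near_cst.
have sc z : smooth_at (fun y : R^o => Gamma (y, 0)) z.
  apply: (@smooth_at_comp _ _ _ _ _ _ (fun y : R^o => (y, 0 : R^o)) Gamma) => //.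
  by apply: smooth_near_pair; [exact: smooth_near_id|exact: smooth_near_cst].
have rk j z : (0 < j)%N -> rank_le j (uncurry3 h) z.
  move=> j0; exact: (@rank_le_curve _ _ _ _ _ (fun y : R^o => Gamma (y, 0))
    (fun z : R^o * R^o * R^o => q z.1.1 z.1.2 z.2 : R^o)).
exists h, 8^-1; split.
- apply/(smooth_intoP _ (@openT (R^o * R^o * R^o)%type)) => y _.
  exact: (@smooth_at_comp _ _ _ _ _ _
    (fun z : R^o * R^o * R^o => q z.1.1 z.1.2 z.2 : R^o) (fun y : R^o => Gamma (y, 0))).
- by split; lra.
- move=> r u tau; rewrite !SE /S' !SE /h /q; split=> [h1|h1|h1|h1|].
  + rewrite !(@bend_start _ _ tau)// !(@bend_start _ _ 0) ?mulr0 ?addr0//; lra.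
  + rewrite !(@bend_end _ _ tau)// !(@bend_end _ _ 1) ?mulr1; last lra.
    by congr (Gamma (_, _)); ring.
  + by rewrite (bend_src _ h1).
  + by rewrite (bend_tgt _ h1).
  + split=> h1; congr (Gamma (_, _)).
      by rewrite (@step0 _ r); [ring|lra].
    by rewrite (@step1 _ r); [ring|lra].
- by move=> z; exact: rk.
- by move=> r tau; split; exact: rk.
Qed.

End Plane.

(** * The second variation of holonomy *)

Section SecondVariation.
Variable R : realType.

Lemma eq_derive0 (W : normedModType R) (f g : R^o -> W) :
  (forall a, f a = g a) -> 'D_1 f 0 = 'D_1 g 0.
Proof. by move=> /funext->. Qed.

Lemma eq_tderive0 n (M : manifoldType R n) (f g : R^o -> M) :
  (forall a, f a = g a) -> tderive f 0 1 = tderive g 0 1.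
Proof. by move=> /funext->. Qed.

Lemma derive_snd (W : normedModType R) (f : R^o * R^o -> W) (a b : R^o) :
  'D_1 (fun c : R^o => f (a, c)) b = 'D_(0, 1) f (a, b).
Proof.
rewrite -[LHS]derive_line -[RHS]derive_line.
apply: (f_equal (fun g : R^o -> W => 'D_(1 : R^o) g (0 : R^o))).
apply/funext => s; congr f.
by rewrite -[RHS]/(a + s *: 0, b + s *: 1) scaler0 addr0.
Qed.

Lemma derive_fst (W : normedModType R) (f : R^o * R^o -> W) (a b : R^o) :
  'D_1 (fun c : R^o => f (c, b)) a = 'D_(1, 0) f (a, b).
Proof.
rewrite -[LHS]derive_line -[RHS]derive_line.
apply: (f_equal (fun g : R^o -> W => 'D_(1 : R^o) g (0 : R^o))).
apply/funext => s; congr f.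
by rewrite -[RHS]/(a + s *: 1, b + s *: 0) scaler0 addr0.
Qed.

Section InManifold.
Variables (n : nat) (M : manifoldType R n) (p : M) (f : R^o * R^o -> M).
Hypothesis sf : forall z, smooth_at f z.

Let fp := cmap (chart_at p) \o f.

Lemma tderive_snd a : f (a, 0) = p ->
  tderive (fun b : R^o => f (a, b)) 0 1 = 'D_(0, 1) fp (a, 0).
Proof. by move=> fa; rewrite /tderive fa -derive_snd. Qed.

Lemma tderive_fst b : f (0, b) = p ->
  tderive (fun a : R^o => f (a, b)) 0 1 = 'D_(1, 0) fp (0, b).
Proof. by move=> fb; rewrite /tderive fb -derive_fst. Qed.

Hypothesis f0 : forall a, f (a, 0) = p.

Let sfp : smooth_near fp (0, 0).
Proof. by apply: (sf _).2; rewrite f0; exact: chart_at_dom. Qed.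

(** The inner derivative is taken in the chart at [p] for every [a], and is thus
    the restriction to an axis of a directional derivative in coordinates. *)
Lemma smooth_near_inner :
  smooth_near (fun a : R^o => tderive (fun b : R^o => f (a, b)) 0 1) 0.
Proof.
rewrite (_ : (fun a : R^o => _) = ('D_(0, 1) fp) \o (fun a : R^o => (a, 0 : R^o))).
  apply: smooth_near_comp; last exact: smooth_near_derive.
  by apply: smooth_near_pair; [exact: smooth_near_id|exact: smooth_near_cst].
by apply/funext => a /=; rewrite tderive_snd.
Qed.

Lemma mixed_derivatives : (forall b, f (0, b) = p) ->
  'D_1 (fun a : R^o => tderive (fun b : R^o => f (a, b)) 0 1) 0 =
  'D_1 (fun b : R^o => tderive (fun a : R^o => f (a, b)) 0 1) 0.
Proof.
move=> f0'.
apply: etrans (eq_derive0 (fun a => tderive_snd (f0 a))) _.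
apply: etrans (esym (eq_derive0 (fun b => tderive_fst (f0' b)))).
have S := schwarz ((1 : R^o), (0 : R^o)) ((0 : R^o), (1 : R^o)) sfp.
have e1 := derive_fst ('D_((0 : R^o), (1 : R^o)) fp) 0 0.
have e2 := derive_snd ('D_((1 : R^o), (0 : R^o)) fp) 0 0.
by apply: etrans e1 _; apply: etrans S _; exact: esym e2.
Qed.

End InManifold.

(** A differential is a continuous linear map. *)
Lemma derive_tmap (V : normedModType R) m n (M : manifoldType R m)
    (N : manifoldType R n) (g : M -> N) (p : M) (q : V -> 'rV[R]_m) x v :
  smooth g -> smooth_near q x ->
  'D_v (fun y => tmap g p (q y)) x = tmap g p ('D_v q x).
Proof.
move=> /smoothP sg sq; have dp := chart_at_dom p.
have [_ gs] := sg p _ (cimg_chart dp).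
have /smooth_near_differentiable d := gs _ (chart_at_dom _).
pose gp := cmap (chart_at ((g \o cinv (chart_at p)) (cmap (chart_at p) p))) \o
  (g \o cinv (chart_at p)).
have tE u : tmap g p u = 'd gp (cmap (chart_at p) p) u by exact: deriveE.
rewrite (_ : (fun y => tmap g p (q y)) = 'd gp (cmap (chart_at p) p) \o q).
  rewrite derive_lin//; last exact: smooth_near_differentiable.
  exact: diff_continuous.
by apply/funext => y; rewrite tE.
Qed.

Section InLieGroup.
Variables (n : nat) (G : lieGroupType R n).

Lemma lie_bracketNl (xi eta : 'rV[R]_n) :
  lie_bracket G (- xi) eta = - lie_bracket G xi eta.
Proof.
have /smooth_near_differentiable d := @smooth_near_Ad R n G eta.
by rewrite /lie_bracket (deriveE _ d) (deriveE _ d) linearN.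
Qed.

(** The chain rule applied to the definition of the bracket. *)
Lemma derive_Ad (f : R^o -> G) (eta : 'rV[R]_n) :
  smooth_at f 0 -> f 0 = 1%g ->
  derivable (fun a => Ad (f a) eta) 0 1 /\
  'D_1 (fun a => Ad (f a) eta) 0 = lie_bracket G (tderive f 0 1) eta.
Proof.
move=> [fc fs] f1; set c := chart_at (1%g : G).
have df : cdom c (f 0) by rewrite f1; exact: chart_at_dom.
have sAd := @smooth_near_Ad R n G eta.
have scf : smooth_near (cmap c \o f) 0 by exact: fs.
have E : \forall a \near (0 : R^o),
    ((fun y => Ad (cinv c y) eta) \o (cmap c \o f)) a = Ad (f a) eta.
  by apply: filterS (near_chartK fc df) => a /= ->.
have sAd' : smooth_near (fun y => Ad (cinv c y) eta) ((cmap c \o f) 0).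
  by rewrite /= f1.
have sc := smooth_near_comp (fd := fin_dim_rV R n) scf sAd'.
split; first by apply: smooth_near_derivable; exact: smooth_near_eq E sc.
rewrite -(near_eq_derive _ E) derive_comp; last 2 first.
  exact: smooth_near_differentiable.
  exact: smooth_near_differentiable.
by rewrite /lie_bracket /tderive /= f1.
Qed.

Variables ver hor : R -> R -> G.
Hypothesis sver : forall z, smooth_at (fun z : R^o * R^o => ver z.1 z.2) z.
Hypothesis shor : forall z, smooth_at (fun z : R^o * R^o => hor z.1 z.2) z.
Hypothesis ver0 : forall a, ver a 0 = 1%g.
Hypothesis hor0 : forall b, hor b 0 = 1%g.

Let swap_smooth (M : manifoldType R n) (f : R -> R -> M) :
  (forall z, smooth_at (fun z : R^o * R^o => f z.1 z.2) z) ->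
  forall z, smooth_at (fun z : R^o * R^o => f z.2 z.1) z.
Proof.
move=> s z; apply: (@smooth_at_comp _ _ _ _ _ _
  (fun z : R^o * R^o => (z.2, z.1)) (fun z : R^o * R^o => f z.1 z.2)) => //.
by apply: smooth_near_pair; [exact: smooth_near_snd|exact: smooth_near_fst].
Qed.

Let slice_smooth (M : manifoldType R n) (f : R -> R -> M) a (b : R^o) :
  (forall z, smooth_at (fun z : R^o * R^o => f z.1 z.2) z) ->
  smooth_at (f a : R^o -> M) b.
Proof.
move=> s; apply: (@smooth_at_comp _ _ _ _ _ _
  (fun b : R^o => (a : R^o, b)) (fun z : R^o * R^o => f z.1 z.2)) => //.
by apply: smooth_near_pair; [exact: smooth_near_cst|exact: smooth_near_id].
Qed.

(** The derivative in [b] at [0] splits into three terms after inserting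
    [hor 0 a] and its inverse.  For the last factor, [hor 0 a * (hor b a)^-1],
    which is [1] on both axes, the two derivatives are exchanged: its derivative
    in [a] at [0] is the difference of the velocities of [hor 0] and [hor b]. *)
Lemma second_variation :
  'D_1 (fun a : R^o => tderive (fun b : R^o =>
     (ver a b * hor 0 a * (hor b a * ver 0 b)^-1)%g) 0 1) 0 =
  'D_1 (fun a : R^o => tderive (ver a : R^o -> G) 0 1) 0
  - 'D_1 (fun b : R^o => tderive (hor b : R^o -> G) 0 1) 0
  + lie_bracket G (tderive (hor 0 : R^o -> G) 0 1)
                  (- tderive (ver 0 : R^o -> G) 0 1).
Proof.
set eta := - tderive (ver 0 : R^o -> G) 0 1.
pose c (z : R^o * R^o) := (hor 0 z.1 * (hor z.2 z.1)^-1)%g.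
have sc z : smooth_at c z.
  apply: smooth_at_mulg; last by apply: smooth_at_invg; exact: swap_smooth.
  apply: (@smooth_at_comp _ _ _ _ _ _ fst (hor 0 : R^o -> G)).
    exact: smooth_near_fst.
  exact: slice_smooth.
have c0 a : c (a, 0) = 1%g by rewrite /c /= mulgV.
have c0' b : c (0, b) = 1%g by rewrite /c /= !hor0 mulgV.
have svi := smooth_at_invg (slice_smooth 0 0 sver).
have svi1 : (ver 0 0)^-1%g = 1%g by rewrite ver0 invg1.
have E a : tderive (fun b : R^o =>
     (ver a b * hor 0 a * (hor b a * ver 0 b)^-1)%g) 0 1 =
    tderive (ver a : R^o -> G) 0 1 + Ad (hor 0 a) eta +
    tderive (fun b : R^o => c (a, b)) 0 1.
  have -> : (fun b : R^o => (ver a b * hor 0 a * (hor b a * ver 0 b)^-1)%g) =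
      (fun b : R^o => (ver a b * (hor 0 a * (ver 0 b)^-1 * (hor 0 a)^-1) * c (a, b))%g).
    by apply/funext => b; rewrite /c /= invgM !mulgA mulgVK.
  have s1 := slice_smooth a 0 sver.
  have s2 : smooth_at (fun b : R^o => (hor 0 a * (ver 0 b)^-1 * (hor 0 a)^-1)%g) 0.
    apply: smooth_at_mulg; last exact: smooth_at_cst.
    by apply: smooth_at_mulg; [exact: smooth_at_cst|exact: svi].
  have s3 : smooth_at (fun b : R^o => c (a, b)) 0.
    apply: (@smooth_at_comp _ _ _ _ _ _ (fun b : R^o => (a : R^o, b)) c) => //.
    by apply: smooth_near_pair; [exact: smooth_near_cst|exact: smooth_near_id].
  have e2 : (hor 0 a * (ver 0 0)^-1 * (hor 0 a)^-1)%g = 1%g.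
    by rewrite svi1 mulg1 mulgV.
  rewrite (tderive_mulg _ (smooth_at_mulg s1 s2) s3)//; last by rewrite ver0 e2 mulg1.
  rewrite (tderive_mulg _ s1 s2 (ver0 a) e2) (tderive_conjg _ _ svi svi1).
  by rewrite (tderive_invg _ (slice_smooth 0 0 sver) (ver0 0)).
have d1 : derivable (fun a : R^o => tderive (ver a : R^o -> G) 0 1) 0 1.
  apply: smooth_near_derivable.
  by apply: (smooth_near_inner (p := 1%g) (f := fun z => ver z.1 z.2)).
have dq : derivable (fun b : R^o => tderive (hor b : R^o -> G) 0 1) 0 1.
  apply: smooth_near_derivable.
  by apply: (smooth_near_inner (p := 1%g) (f := fun z => hor z.1 z.2)).
have [d2 e2] := derive_Ad eta (slice_smooth 0 0 shor) (hor0 0).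
have d3 : derivable (fun a : R^o => tderive (fun b : R^o => c (a, b)) 0 1) 0 1.
  by apply: smooth_near_derivable; apply: (smooth_near_inner (p := 1%g)).
have e3 : 'D_1 (fun a : R^o => tderive (fun b : R^o => c (a, b)) 0 1) 0 =
    - 'D_1 (fun b : R^o => tderive (hor b : R^o -> G) 0 1) 0.
  apply: etrans (mixed_derivatives sc c0 c0') _.
  have dc := @derivable_cst R R^o _ (tderive (hor 0 : R^o -> G) 0 1) 0 1.
  apply: etrans (etrans (deriveB dc dq) _); last by rewrite derive_cst sub0r.
  apply: eq_derive0 => b; have s0 := slice_smooth 0 0 shor.
  have sb := slice_smooth b 0 shor.
  have hb : (hor b 0)^-1%g = 1%g by rewrite hor0 invg1.
  apply: etrans (tderive_mulg _ s0 (smooth_at_invg sb) (hor0 0) hb) _.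
  by rewrite (tderive_invg _ sb (hor0 b)).
apply: etrans (eq_derive0 E) _.
apply: etrans (deriveD (derivableD d1 d2) d3) _.
have D12 := deriveD d1 d2.
pose add (x y : 'rV[R]_n) := x + y.
have E12 := etrans D12 (f_equal2 add erefl e2).
exact: etrans (f_equal2 add E12 e3) (addrAC _ _ _).
Qed.

End InLieGroup.
End SecondVariation.

(** * The curvature equation *)

(** A multiple of a rescaled sine is bounded by any given constant and has
    derivative [1] at [0]: it maps the whole plane into a chart, without
    changing derivatives at the origin. *)
Lemma exists_squeeze (R : realType) (V : normedModType R) (U : set V) (y v w : V) :
  open U -> U y -> exists kap : R^o -> R^o,
    [/\ forall a, smooth_near kap a, kap 0 = 0, 'D_1 kap 0 = 1 &
        forall a b, U (y + (kap a : R) *: v + (kap b : R) *: w)].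
Proof.
move=> oU Uy.
have /nbhs_ballP[r /= r0 B] := open_nbhs_nbhs (conj oU Uy).
pose d := r / (2 * (`|v| + `|w| + 1)).
have n0 : 0 < `|v| + `|w| + 1 by rewrite ltr_wpDl// addr_ge0.
have d0 : 0 < d by rewrite divr_gt0// mulr_gt0.
pose kap (a : R^o) : R^o := d * sin (a * d^-1).
have slin (a : R^o) : smooth_near (fun a : R^o => a * d^-1 : R^o) a.
  by apply: smooth_nearM; [exact: smooth_near_id|exact: smooth_near_cst].
have ssin (a : R^o) :=
  smooth_near_comp (fd := fin_dim_regular R) (slin a) (smooth_near_sin _).
have skap a : smooth_near kap a.
  by apply: smooth_nearM; [exact: smooth_near_cst|exact: ssin].
exists kap; split=> //.
- by rewrite /kap mul0r sin0 mulr0.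
- have h1 : is_derive (0 : R) 1 (fun a : R => a * d^-1) d^-1.
    have h0 := is_deriveM (is_derive_id (0 : R) 1) (is_derive_cst d^-1 (0 : R) 1).
    by apply: (is_derive_eq h0); rewrite scaler0 add0r [LHS]mulr1.
  have h2 := @is_derive1_comp R sin (fun a => a * d^-1) 0 _ _ (is_derive_sin _) h1.
  have h3 := is_deriveZ d h2.
  rewrite (_ : kap = d \*: (sin \o (fun a => a * d^-1)))//.
  rewrite (@derive_val _ _ _ _ _ _ _ h3).
  by rewrite mul0r cos0 mul1r [LHS]mulfV// gt_eqF.
move=> a b; apply: B; rewrite -ball_normE /ball_ /=.
have kapd c : `|kap c : R| <= d.
  by rewrite /kap normrM (gtr0_norm d0) -[X in _ <= X]mulr1 ler_pM2l//; exact: sin_max.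
rewrite -addrA opprD addrA subrr sub0r normrN.
apply: le_lt_trans (ler_normD _ _) _; rewrite (normrZ (kap a)) (normrZ (kap b)).
apply: (@le_lt_trans _ _ (d * `|v| + d * `|w|)).
  by apply: lerD; apply: ler_wpM2r => //; exact: kapd.
have -> : r = d * (2 * (`|v| + `|w| + 1)).
  by rewrite /d divfK// gt_eqF// mulr_gt0.
have := normr_ge0 v; have := normr_ge0 w.
by rewrite -mulrDr ltr_pM2l//; lra.
Qed.

Section Squeeze.
Variables (R : realType) (kap : R^o -> R^o).
Hypotheses (skap : forall a, smooth_near kap a) (kap0 : kap 0 = 0).
Hypothesis dkap : 'D_1 kap 0 = 1.

Let ray_smooth (V : normedModType R) (y u : V) a :
  smooth_near (fun a : R^o => y + (kap a : R) *: u) a.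
Proof.
apply: smooth_nearD; first exact: smooth_near_cst.
by apply: smooth_nearZ => //; exact: smooth_near_cst.
Qed.

Lemma derive_squeeze (V W : normedModType R) (f : V -> W) (y u : V) :
  differentiable f y ->
  'D_1 (fun a : R^o => f (y + (kap a : R) *: u)) 0 = 'D_u f y.
Proof.
move=> df; have ds := smooth_near_differentiable (ray_smooth y u 0).
have df' : differentiable f (y + (kap 0 : R) *: u) by rewrite kap0 scale0r addr0.
have dcomp := derive_comp (1 : R^o) ds df'.
apply: (etrans dcomp); rewrite kap0 scale0r addr0.
have dk := smooth_near_differentiable (skap 0).
have [d1 e1] := differentiable_scale dk (@differentiable_cst R R^o V u 0).
have -> : 'D_1 (fun a : R^o => y + (kap a : R) *: u) 0 = u; last by [].
have dc := @derivable_cst R R^o V y 0 1.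
have d1' : derivable (fun a : R^o => (kap a : R) *: u) 0 1 := diff_derivable d1.
have e1' : 'D_1 (fun a : R^o => (kap a : R) *: u) 0 = u.
  by apply: (etrans (e1 1)); rewrite derive_cst scaler0 add0r dkap scale1r.
apply: (etrans (deriveD dc d1')).
by rewrite derive_cst add0r e1'.
Qed.

Lemma tderive_squeeze n (X : manifoldType R n) (x : X) (y u : 'rV[R]_n) :
  cimg (chart_at x) y ->
  tderive (fun a : R^o => cinv (chart_at x) (y + (kap a : R) *: u)) 0 1 =
  tderive (cinv (chart_at x)) y u.
Proof.
move=> cy; have [_ s] := smooth_at_cinv cy.
have /smooth_near_differentiable d := s _ (chart_at_dom _).
rewrite /tderive kap0 scale0r addr0.
exact: (derive_squeeze u d).
Qed.

End Squeeze.

Lemma tderive_chart_base (R : realType) n (X : manifoldType R n) (x : X) v :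
  tderive (cinv (chart_at x)) (cmap (chart_at x) x) v = v.
Proof.
have dx := chart_at_dom x; rewrite /tderive cmapK//.
have E : \forall z \near cmap (chart_at x) x,
    id z = (cmap (chart_at x) \o cinv (chart_at x)) z.
  by apply: filterS (near_cimg (cimg_chart dx)) => z cz; rewrite /= cinvK.
by rewrite -(near_eq_derive _ E) derive_id.
Qed.

Theorem proposition2p8 (R : realType) (n m k : nat) (X : manifoldType R n)
    (G : lieGroupType R m) (H : lieGroupType R k)
    (t : H -> G) (alpha : G -> H -> H)
    (F1 : (R -> X) -> G) (F2 : (R -> R -> X) -> G * H)
    (A : form1 m X) (B : form2 k X) :
  crossed_module t alpha ->
  smooth_2functor t alpha F1 F2 ->
  is_form1 A -> is_form1_of F1 A ->
  is_form2 B -> is_form2_of F2 B ->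
  forall (x : X) (v w : 'rV[R]_n),
    ext_deriv A x v w + bracket_wedge G A x v w = tmap t 1%g (B x v w).
Proof.
move=> cmod F [_ sA] hA _ hB x v w.
set c := chart_at x; set y0 := cmap c x.
have cy0 : cimg c y0 by apply: cimg_chart; exact: chart_at_dom.
have oc : open (cimg c) by exact: cimg_open.
have [kap [sk k0 dk Uk]] := exists_squeeze v w oc cy0.
pose Gamma (z : R^o * R^o) : X := cinv c (y0 + (kap z.1 : R) *: v + (kap z.2 : R) *: w).
have sGamma z : smooth_at Gamma z.
  apply: (@smooth_at_comp _ _ _ _ _ _ (fun z : R^o * R^o =>
    y0 + (kap z.1 : R) *: v + (kap z.2 : R) *: w) (cinv c)); last first.
    by apply: smooth_at_cinv; exact: Uk.
  have s1 := smooth_near_comp (fd := fin_dim_regular R) (smooth_near_fst z) (sk _).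
  have s2 := smooth_near_comp (fd := fin_dim_regular R) (smooth_near_snd z) (sk _).
  apply: smooth_nearD; first apply: smooth_nearD; first exact: smooth_near_cst.
    by apply: smooth_nearZ => //; exact: smooth_near_cst.
  by apply: smooth_nearZ => //; exact: smooth_near_cst.
have cv a : cimg c (y0 + (kap a : R) *: v).
  by have := Uk a 0; rewrite k0 scale0r addr0.
have cw b : cimg c (y0 + (kap b : R) *: w).
  by have := Uk 0 b; rewrite k0 scale0r addr0.
have dv a : tderive (fun b : R^o => Gamma (a, b)) 0 1 =
    tderive (cinv c) (y0 + (kap a : R) *: v) w.
  exact: (tderive_squeeze sk k0 dk w (cv a)).
have dw b : tderive (fun a : R^o => Gamma (a, b)) 0 1 =
    tderive (cinv c) (y0 + (kap b : R) *: w) v.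
  apply: etrans (tderive_squeeze sk k0 dk v (cw b)).
  by apply: eq_tderive0 => a; rewrite /Gamma /= addrAC.
have sslice1 a : smooth_into [set: R^o] (fun b : R^o => Gamma (a, b)).
  apply/(smooth_intoP _ (@openT R^o)) => b _.
  apply: (@smooth_at_comp _ _ _ _ _ _ (fun b : R^o => (a, b)) Gamma) => //.
  by apply: smooth_near_pair; [exact: smooth_near_cst|exact: smooth_near_id].
have sslice2 b : smooth_into [set: R^o] (fun a : R^o => Gamma (a, b)).
  apply/(smooth_intoP _ (@openT R^o)) => a _.
  apply: (@smooth_at_comp _ _ _ _ _ _ (fun a : R^o => (a, b)) Gamma) => //.
  by apply: smooth_near_pair; [exact: smooth_near_id|exact: smooth_near_cst].
pose V' := ver F1 Gamma; pose H' := hor F1 Gamma.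
have tver a : tderive (V' a : R^o -> G) 0 1 =
    - form1_in_chart A x (y0 + (kap a : R) *: v) w.
  have := hA _ (fun b tau => step tau * b) (sslice1 a) (@line_path_step R).
  rewrite dv /Gamma /= k0 scale0r addr0 => E.
  by rewrite /form1_in_chart E opprK.
have thor b : tderive (H' b : R^o -> G) 0 1 =
    - form1_in_chart A x (y0 + (kap b : R) *: w) v.
  have := hA _ (fun b tau => step tau * b) (sslice2 b) (@line_path_step R).
  rewrite dw /Gamma /= k0 scale0r addr0 => E.
  by rewrite /form1_in_chart E opprK.
have formE u : form1_in_chart A x y0 u = A x u.
  by rewrite /form1_in_chart tderive_chart_base cmapK//; exact: chart_at_dom.
have y0E u : y0 + (kap 0 : R) *: u = y0 by rewrite k0 scale0r addr0.
have dform u' u :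
    'D_1 (fun a : R^o => - form1_in_chart A x (y0 + (kap a : R) *: u') u) 0 =
    - 'D_u' (form1_in_chart A x ^~ u) y0.
  have sf : smooth_near (form1_in_chart A x ^~ u) y0.
    exact: (smooth_onP _ oc).1 (sA x u) y0 cy0.
  have dN := smooth_near_differentiable (smooth_nearN sf).
  apply: etrans (derive_squeeze sk k0 dk u' dN) _.
  exact: (deriveN (smooth_near_derivable (v := u') sf)).
have ver0 a : V' a 0 = 1%g.
  rewrite /V' /ver (_ : (fun tau => _) = fun=> Gamma (a, 0)) ?(f1_id F)//.
  by apply/funext => tau; rewrite mulr0.
have hor0 b : H' b 0 = 1%g.
  rewrite /H' /hor (_ : (fun tau => _) = fun=> Gamma (0, b)) ?(f1_id F)//.
  by apply/funext => tau; rewrite mulr0.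
have SV := second_variation (smooth_at_ver F sGamma) (smooth_at_hor F sGamma) ver0 hor0.
pose S' := sqr F2 Gamma.
have ssqr := smooth_at_sqr F sGamma.
have st := cm_t_smooth cmod.
have E a : tderive (fun b : R^o => (V' a b * H' 0 a * (H' b a * V' 0 b)^-1)%g) 0 1 =
    tmap t 1%g (tderive (S' a : R^o -> H) 0 1).
  rewrite -[1%g in RHS](sqr0 F sGamma a) -tderive_map//; last first.
    apply: (@smooth_at_comp _ _ _ _ _ _ (fun b : R^o => (a : R^o, b))
      (fun z : R^o * R^o => S' z.1 z.2)) => //.
    by apply: smooth_near_pair; [exact: smooth_near_cst|exact: smooth_near_id].
  by apply: eq_tderive0 => b; rewrite /= (t_sqr F sGamma).
have L := derive_tmap 1%g (1 : R^o) st
  (smooth_near_inner (p := 1%g) (f := fun z => S' z.1 z.2) ssqr (sqr0 F sGamma)).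
have BE : B x v w =
    - 'D_1 (fun a : R^o => tderive (S' a : R^o -> H) 0 1) 0.
  have sG : smooth_into setT Gamma.
    by apply/(smooth_intoP _ (@openT (R^o * R^o)%type)) => z _.
  have := hB _ _ sG (@square_bigonP R).
  have -> : Gamma 0 = x.
    by rewrite /Gamma /= !y0E cmapK//; exact: chart_at_dom.
  have -> : tderive Gamma 0 (1, 0) = v.
    apply: etrans (esym (tderive_line Gamma 0 (1, 0))) _.
    apply: etrans (eq_tderive0 (g := fun a => Gamma (a, 0)) _) _ => [a|].
      by rewrite add0r -[_ *: _]/(a *: 1, a *: 0) scaler0 [a *: 1]mulr1.
    by rewrite dw y0E tderive_chart_base.
  have -> : tderive Gamma 0 (0, 1) = w.
    apply: etrans (esym (tderive_line Gamma 0 (0, 1))) _.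
    apply: etrans (eq_tderive0 (g := fun b => Gamma (0, b)) _) _ => [b|].
      by rewrite add0r -[_ *: _]/(b *: 0, b *: 1) scaler0 [b *: 1]mulr1.
    by rewrite dv y0E tderive_chart_base.
  by [].
have dV := etrans (eq_derive0 tver) (dform v w).
have dH := etrans (eq_derive0 thor) (dform w v).
have LB : tmap t 1%g (- B x v w) = - 'D_v (form1_in_chart A x ^~ w) y0
    - - 'D_w (form1_in_chart A x ^~ v) y0 + lie_bracket G (- A x v) (A x w).
  rewrite BE opprK; apply: etrans (esym L) _.
  apply: etrans (esym (eq_derive0 E)) _; apply: etrans SV _.
  have -> : tderive (H' 0 : R^o -> G) 0 1 = - A x v by rewrite thor y0E formE.
  have -> : tderive (V' 0 : R^o -> G) 0 1 = - A x w by rewrite tver y0E formE.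
  by rewrite opprK dV dH.
apply: oppr_inj; rewrite -(tmapN 1%g _ st) LB lie_bracketNl.
by rewrite /ext_deriv /bracket_wedge !opprD.
Qed.
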